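(* Let $d\ge2$ and let $X_1,\ldots,X_n$ be independent random vectors in $\mathbb{R}^d$, each distributed according to the probability measure $\mu(dx)=\phi(x)dx$. Suppose that $\phi$ is even, has positive integrable Fourier transform, and that for each $t\in\mathbb{R}^d$ the function $[0,+\infty)\ni r\mapsto\hat\phi(\sqrt r\,t)$ is log-convex. Assume moreover that $\mathbb{E}|X_1|^N<\infty$ for each $N>0$. Let $K$ be a symmetric star body in $\mathbb{R}^d$ that is the intersection body of a symmetric star body $L\subset\mathbb{R}^d$. Then, if $\mathbb{E}\|X_1\|_K^{-1}<\infty$, the function $$[0,+\infty)^n\ni(a_1,\ldots,a_n)\mapsto\mathbb{E}\left\|\sqrt{a_1}X_1+\cdots+\sqrt{a_n}X_n\right\|_K^{-1}$$ is log-convex.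
   Context: Fourier transform convention: $\hat f(x)=\int_{\mathbb{R}^d}f(y)e^{-2\pi i\langle x,y\rangle}dy$; ''positive'' means $\ge0$. $|\cdot|$ is the Euclidean norm of vectors, and the Lebesgue measure (of the relevant dimension) of sets. A set $K\subset\mathbb{R}^d$ is a star body if it is compact, $tx\in K$ for all $x\in K$, $t\in[0,1]$, and its Minkowski functional $\|x\|_K=\inf\{\lambda>0:x\in\lambda K\}$ is (finite and) continuous on $\mathbb{R}^d$; it is symmetric if $K=-K$. $K$ is the intersection body of $L$ if for every $\theta\in S^{d-1}$, $\|\theta\|_K=|L\cap\theta^\perp|^{-1}$, where $\theta^\perp=\{x:\langle x,\theta\rangle=0\}$ and $|L\cap\theta^\perp|$ is $(d-1)$-dimensional volume. A function $f:C\to[0,+\infty]$ on a convex set is log-convex if $f(\lambda x+(1-\lambda)y)\le f(x)^\lambda f(y)^{1-\lambda}$ for all $x,y\in C$, $\lambda\in(0,1)$; convention $\|0\|_K^{-1}=+\infty$, so the function above has value $+\infty$ at $a=0$. *)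

(* Defs.v *)
From HB Require Import structures.
From mathcomp Require Import all_boot all_order all_algebra.
From mathcomp Require Import all_classical all_reals all_analysis.
From mathcomp Require Import complex ring.
Set Implicit Arguments.
Unset Strict Implicit.
Unset Printing Implicit Defensive.
Import Order.TTheory GRing.Theory Num.Theory.
Import numFieldNormedType.Exports.
Local Open Scope classical_set_scope.
Local Open Scope ring_scope.

(* The library has no sigma-algebra on row vectors: they are given the one
   generated by the coordinates, as [n.-tuple T] is. Over the reals, this is the
   Borel sigma-algebra. *)

Definition measure_rV_display : measure_display -> measure_display.
Proof. exact. Qed.

Section measurable_rV.
Context {d} {T : sigmaRingType d}.
Variable n : nat.

Let coors : 'I_n -> 'rV[T]_n -> T := fun i v => v ord0 i.

Let rV_set0 : g_sigma_preimage coors set0.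
Proof. exact: sigma_algebra0. Qed.

Let rV_setC A : g_sigma_preimage coors A -> g_sigma_preimage coors (~` A).
Proof. exact: sigma_algebraC. Qed.

Let rV_bigcup (F : _^nat) : (forall i, g_sigma_preimage coors (F i)) ->
  g_sigma_preimage coors (\bigcup_i (F i)).
Proof. exact: sigma_algebra_bigcup. Qed.

HB.instance Definition _ := @isMeasurable.Build (measure_rV_display d)
  'rV[T]_n (g_sigma_preimage coors) rV_set0 rV_setC rV_bigcup.

End measurable_rV.

Lemma measurable_coord d (T : sigmaRingType d) n (i : 'I_n) :
  measurable_fun [set: 'rV[T]_n] (fun v : 'rV[T]_n => v ord0 i).
Proof.
move=> _ Y mY; rewrite setTI; apply: sub_sigma_algebra => /=.
rewrite -bigcup_seq/=; exists i => /=; first by rewrite mem_index_enum.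
by exists Y => //; rewrite setTI.
Qed.

Lemma measurable_fun_rVP d1 d2 (T1 : measurableType d1) (T2 : measurableType d2)
    n (f : T1 -> 'rV[T2]_n) :
  measurable_fun [set: T1] f <->
  forall i, measurable_fun [set: T1] (fun x => f x ord0 i).
Proof.
split=> [mf i|mf].
  by apply: (measurableT_comp (measurable_coord i) mf).
move=> _ A mA; rewrite setTI.
have : <<s \big[setU/set0]_(i < n) preimage_set_system setT
  (fun v : 'rV[T2]_n => v ord0 i) measurable >>
    `<=` [set B | measurable (f @^-1` B)].
  apply: smallest_sub.
    split => /=.
    - by rewrite preimage_set0.
    - by move=> B mB; rewrite setTD preimage_setC; exact: measurableC.
    - move=> F mF; rewrite preimage_bigcup.
      exact: bigcupT_measurable.
  rewrite -bigcup_seq => B [i _ [Y mY <-]] /=.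
  by rewrite setTI -[X in measurable X]setTI; exact: mf.
exact.
Qed.

Section lebesgue_rV.
Context {R : realType}.

Definition rV_cons n (p : measurableTypeR R * 'rV[R]_n) : 'rV[R]_n.+1 :=
  row_mx (p.1)%:M p.2 : 'rV[R]_(1 + n).

Definition rV_split n (v : 'rV[R]_n.+1) : measurableTypeR R * 'rV[R]_n :=
  (v ord0 ord0, \row_j v ord0 (lift ord0 j)).

(* Lebesgue measure on R^n, as the iterated product of the one-dimensional one;
   see [lebesgue_rV_box] for its values on boxes. *)
Fixpoint lebesgue_rV n : set 'rV[R]_n -> \bar R :=
  match n with
  | 0%N => \d_(0 : 'rV[R]_0)
  | m.+1 => pushforward (@lebesgue_measure R \x @lebesgue_rV m)%E (@rV_cons m)
  end.

Lemma rV_cons0 n (p : R * 'rV[R]_n) : rV_cons p ord0 ord0 = p.1.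
Proof.
have e : (ord0 : 'I_n.+1) = lshift n (ord0 : 'I_1) by exact: val_inj.
rewrite /rV_cons e; apply: etrans (row_mxEl _ _ _ _) _.
by rewrite mxE.
Qed.

Lemma rV_consS n (p : R * 'rV[R]_n) j :
  rV_cons p ord0 (lift ord0 j) = p.2 ord0 j.
Proof.
have e : lift ord0 j = rshift 1 j by exact: val_inj.
by rewrite /rV_cons e; exact: row_mxEr.
Qed.

Lemma rV_consK n : cancel (@rV_cons n) (@rV_split n).
Proof.
move=> [x v]; rewrite /rV_split rV_cons0; congr pair.
by apply/rowP => j; rewrite mxE rV_consS.
Qed.

Lemma rV_splitK n : cancel (@rV_split n) (@rV_cons n).
Proof.
move=> v; apply/rowP => i; have [j ->|->] := unliftP ord0 i; last first.
  by rewrite rV_cons0.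
by rewrite rV_consS mxE.
Qed.

Lemma measurable_rV_cons n : measurable_fun setT (@rV_cons n).
Proof.
apply/measurable_fun_rVP => i; have [j ->|->] := unliftP ord0 i; last first.
  by under eq_fun do rewrite rV_cons0; exact: measurable_fst.
under eq_fun do rewrite rV_consS.
exact: (measurableT_comp (measurable_coord j) measurable_snd).
Qed.

Lemma measurable_rV_split n : measurable_fun setT (@rV_split n).
Proof.
apply/measurable_fun_pair; first exact: measurable_coord.
apply/measurable_fun_rVP => i; under eq_fun do rewrite mxE.
exact: measurable_coord.
Qed.

Lemma lebesgue_rV_sigma_finite n :
  exists mu : {sigma_finite_measure set 'rV[R]_n -> \bar R},
    mu = @lebesgue_rV n :> (set 'rV[R]_n -> \bar R).
Proof.
elim: n => [|n [mu muE]].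
  pose mu : {measure set 'rV[R]_0 -> \bar R} := \d_(0 : 'rV[R]_0).
  have sf : sigma_finite setT mu.
    exists (fun=> setT); first by rewrite bigcup_const//; exists 0%N.
    by move=> _; split => //; rewrite /mu/= diracT ltry.
  by exists (HB.pack_for {sigma_finite_measure set 'rV[R]_0 -> \bar R}
    (Measure.sort mu) (Measure_isSigmaFinite.Build _ _ _ (Measure.sort mu) sf)).
pose m1 : {sigma_finite_measure set (measurableTypeR R) -> \bar R} :=
  @lebesgue_measure R.
pose prd : {measure set (measurableTypeR R * 'rV[R]_n)%type -> \bar R} :=
  (m1 \x mu)%E.
have prd_sf : sigma_finite setT prd.
  have /sigma_finiteP[F [TF ndF Foo]] := sigma_finiteT m1.
  have /sigma_finiteP[G [TG ndG Goo]] := sigma_finiteT mu.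
  exists (fun k => F k `*` G k).
    rewrite -setXTT TF TG predeqE => -[x y]; split.
      move=> [/= [i _ Fix] [k _ Gky]]; exists (maxn i k) => //; split.
      - by move: x Fix; exact/subsetPset/ndF/leq_maxl.
      - by move: y Gky; exact/subsetPset/ndG/leq_maxr.
    by move=> [i _ []/= ? ?]; split; exists i.
  move=> k; have [? ?] := Foo k; have [? ?] := Goo k.
  split; first exact: measurableX.
  by rewrite /prd/= product_measure1E// lte_mul_pinfty// ge0_fin_numE.
pose nu : {measure set 'rV[R]_n.+1 -> \bar R} :=
  measure_function_pushforward__canonical__measure_function_Measure
    prd (@measurable_rV_cons n).
have sf : sigma_finite setT nu.
  have [F FT mF] := prd_sf.
  exists (fun i => @rV_split n @^-1` F i).
    by rewrite -preimage_bigcup -FT preimage_setT.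
  move=> i; have [mFi Fioo] := mF i; split.
    by rewrite -[X in measurable X]setTI; exact: measurable_rV_split.
  rewrite /nu/= /pushforward -comp_preimage.
  rewrite (_ : _ \o _ = id) ?preimage_id//.
  by apply/funext => p; exact: rV_consK.
exists (HB.pack_for {sigma_finite_measure set 'rV[R]_n.+1 -> \bar R}
  (Measure.sort nu) (Measure_isSigmaFinite.Build _ _ _ (Measure.sort nu) sf)).
by rewrite /nu /prd/m1/= muE.
Qed.

Section lebesgue_rV_measure.
Variable n : nat.

Let lebesgue_rV0 : @lebesgue_rV n set0 = 0%E.
Proof. by have [mu <-] := lebesgue_rV_sigma_finite n; exact: measure0. Qed.

Let lebesgue_rV_ge0 A : (0 <= @lebesgue_rV n A)%E.
Proof. by have [mu <-] := lebesgue_rV_sigma_finite n; exact: measure_ge0. Qed.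

Let lebesgue_rV_sigma_additive : semi_sigma_additive (@lebesgue_rV n).
Proof.
have [mu <-] := lebesgue_rV_sigma_finite n.
exact: measure_semi_sigma_additive.
Qed.

HB.instance Definition _ := isMeasure.Build _ _ _ (@lebesgue_rV n)
  lebesgue_rV0 lebesgue_rV_ge0 lebesgue_rV_sigma_additive.

Let lebesgue_rV_sf : sigma_finite setT (@lebesgue_rV n).
Proof. by have [mu <-] := lebesgue_rV_sigma_finite n; exact: sigma_finiteT. Qed.

HB.instance Definition _ := Measure_isSigmaFinite.Build _ _ _ (@lebesgue_rV n)
  lebesgue_rV_sf.

End lebesgue_rV_measure.

Lemma lebesgue_rV_box n (A : 'I_n -> set R) :
  (forall i, measurable (A i)) ->
  lebesgue_rV [set v : 'rV[R]_n | forall i, A i (v ord0 i)] =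
  (\prod_(i < n) lebesgue_measure (A i))%E.
Proof.
elim: n A => [|n IH] A mA.
  rewrite big_ord0 /= (_ : [set v | _] = setT) ?diracT//.
  by apply/seteqP; split => // v _ [].
rewrite big_ord_recl -(IH (fun i => A (lift ord0 i)))//.
rewrite [LHS]/= /pushforward -product_measure1E//; last first.
  rewrite (_ : [set v | _] = \big[setI/setT]_(i < n)
    ((fun v : 'rV[R]_n => v ord0 i) @^-1` A (lift ord0 i))).
    apply: bigsetI_measurable => i _.
    by rewrite -[X in measurable X]setTI; exact: measurable_coord.
  rewrite -bigcap_seq; apply/seteqP; split => v /= vA i.
    by move=> _; exact: vA.
  by apply: vA; rewrite /= mem_index_enum.
  exact: mA.
apply: (congr1 (@lebesgue_measure R \x @lebesgue_rV n)%E); apply/seteqP; split => -[x v] /=.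
  move=> vA; split; first by have := vA ord0; rewrite rV_cons0.
  by move=> i; have := vA (lift ord0 i); rewrite rV_consS.
move=> [/= xA vA] i; have [j ->|->] := unliftP ord0 i; last first.
  by rewrite rV_cons0.
by rewrite rV_consS; exact: vA.
Qed.

End lebesgue_rV.
Arguments lebesgue_rV {R n} A : rename.

Section fourier.
Context {R : realType}.
Local Open Scope complex_scope.

Definition Cintegral d (T : measurableType d) (mu : {measure set T -> \bar R})
    (D : set T) (f : T -> R[i]) : R[i] :=
  Rintegral mu D (fun x => complex.Re (f x)) +i* Rintegral mu D (fun x => complex.Im (f x)).

Definition Cintegrable d (T : measurableType d)
    (mu : {measure set T -> \bar R}) (D : set T) (f : T -> R[i]) : Prop :=
  mu.-integrable D (fun x => (complex.Re (f x))%:E) /\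
  mu.-integrable D (fun x => (complex.Im (f x))%:E).

Definition cis (t : R) : R[i] := cos t +i* sin t.

Definition dotp n (x y : 'rV[R]_n) : R := \sum_(i < n) x ord0 i * y ord0 i.

(* The norm [`|x|] of the library on ['rV[R]_n] is the sup norm. *)
Definition enorm n (x : 'rV[R]_n) : R := Num.sqrt (dotp x x).

Definition fourier n (f : 'rV[R]_n -> R[i]) (x : 'rV[R]_n) : R[i] :=
  Cintegral lebesgue_rV setT
    (fun y => f y * cis (- (2 * pi * dotp x y))).

End fourier.

Section log_convex.
Context {R : realType}.

(* [`^] is the power of [\bar R] to a real exponent: [+oo `^ l = +oo] for
   [0 < l]. The library convention [0 * +oo = 0] matters only for a function that
   takes both values [0] and [+oo]. *)
Definition log_convex_on (V : lmodType R) (C : set V) (f : V -> \bar R) : Prop :=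
  forall (x y : V) (l : R), C x -> C y -> 0 < l < 1 ->
    (f (l *: x + (1 - l) *: y)%R <= f x `^ l * f y `^ (1 - l)%R)%E.

End log_convex.

Section star_bodies.
Context {R : realType} {d : nat}.
Implicit Types K L A : set 'rV[R]_d.

(* The value is [+oo] when no dilate of [K] contains [x]. *)
Definition minkowski_functional K (x : 'rV[R]_d) : \bar R :=
  ereal_inf [set l%:E | l in [set l : R | 0 < l /\ [set l *: y | y in K] x]].

Definition star_body K : Prop :=
  [/\ compact K,
      forall x (t : R), K x -> 0 <= t <= 1 -> K (t *: x),
      forall x, minkowski_functional K x \is a fin_num &
      continuous (minkowski_functional K)].

Definition symmetric_set K : Prop := [set - x | x in K] = K.

Definition hyperplane (theta : 'rV[R]_d) : set 'rV[R]_d :=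
  [set x | dotp x theta = 0].

Definition orthonormal_frame (theta : 'rV[R]_d) : set 'M[R]_(d.-1, d) :=
  [set B | B *m B^T = 1%:M /\ B *m theta^T = 0].

(* The (d-1)-dimensional volume of a subset [A] of the hyperplane orthogonal to
   [theta], read in an orthonormal basis of this hyperplane (the rows of the
   chosen frame); by rotation invariance of the Lebesgue measure the choice of
   the basis is immaterial. *)
Definition hyperplane_volume (theta : 'rV[R]_d) A : \bar R :=
  lebesgue_rV [set y : 'rV[R]_d.-1 | A (y *m get (orthonormal_frame theta))].

(* In [\bar R], [0^-1 = +oo] and [+oo^-1 = 0]. *)
Definition is_intersection_body K L : Prop :=
  forall theta : 'rV[R]_d, enorm theta = 1 ->
    minkowski_functional K theta =
    (hyperplane_volume theta (L `&` hyperplane theta))^-1%E.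

End star_bodies.

Lemma orthonormal_frame_nonempty (R : realType) (d : nat) (theta : 'rV[R]_d) :
  enorm theta = 1 -> orthonormal_frame theta !=set0.
Proof.
case: d theta => [|d] theta th1.
  by exists 0; split; apply/matrixP => -[m /= mlt].
have dotpE (x y : 'rV[R]_d.+1) : x *m y^T = (dotp x y)%:M.
  apply/matrixP => i j; rewrite !ord1 !mxE eqxx mulr1n.
  by apply: eq_bigr => k _; rewrite mxE.
have thth : theta *m theta^T = 1.
  rewrite dotpE; congr (_%:M); rewrite -[RHS](expr1n _ 2) -th1 sqr_sqrtr//.
  by apply: sumr_ge0 => i _; rewrite -expr2 sqr_ge0.
pose e : 'rV[R]_d.+1 := delta_mx ord0 ord0.
have ee : e *m e^T = 1.
  by rewrite trmx_delta mul_delta_mx; apply/matrixP => i j; rewrite !ord1 !mxE.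
have the : theta *m e^T = (theta ord0 ord0)%:M.
  rewrite trmx_delta; apply/matrixP => i j; rewrite !ord1 !mxE eqxx mulr1n.
  rewrite (bigD1 ord0)//= big1 ?addr0 ?mxE ?eqxx ?mulr1// => k k0.
  by rewrite mxE (negPf k0) mulr0.
have eth : e *m theta^T = (theta ord0 ord0)%:M.
  by rewrite -[RHS]tr_scalar_mx -the trmx_mul trmxK.
(* the Householder reflection exchanging [e] and [theta] *)
suff [H HH eH] : exists2 H : 'M[R]_d.+1, H *m H^T = 1%:M & e *m H = theta.
  exists (rowsub (lift ord0) H); split.
    apply/matrixP => i j; rewrite !mxE.
    have := congr1 (fun M : 'M[R]_d.+1 => M (lift ord0 i) (lift ord0 j)) HH.
    rewrite !mxE (inj_eq lift_inj) => <-.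
    by apply: eq_bigr => k _; rewrite !mxE.
  apply/matrixP => i j; rewrite -eH ord1 !mxE.
  have HH0 : (H *m H^T) (lift ord0 i) ord0 = 0 by rewrite HH mxE.
  rewrite -[RHS]HH0 mxE; apply: eq_bigr => k _.
  rewrite !mxE (bigD1 ord0)//= big1 ?addr0 ?mxE ?eqxx ?mul1r //= => l l0.
  by rewrite mxE (negPf l0) andbF mul0r.
have [->|the'] := eqVneq theta e.
  by exists 1%:M; rewrite ?trmx1 ?mulmx1.
pose v := theta - e.
pose c := 1 - theta ord0 ord0.
have vv : v *m v^T = (2 * c)%:M.
  rewrite /v linearB/= mulmxBl !mulmxBr thth the eth ee.
  apply/matrixP => i j; rewrite !ord1 !mxE !eqxx /c !mulr1n.
  by ring.
have c0 : c != 0.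
  apply: contra the' => /eqP c0; move: vv; rewrite c0 mulr0 dotpE => /matrixP.
  move=> /(_ ord0 ord0); rewrite !mxE eqxx !mulr1n => /eqP.
  rewrite psumr_eq0; last by move=> i _; rewrite -expr2 sqr_ge0.
  move=> /allP v0; rewrite -subr_eq0; apply/eqP/rowP => i.
  have := v0 i; rewrite mem_index_enum => /(_ isT).
  by rewrite mulf_eq0 orbb => /eqP ->; rewrite mxE.
pose Q := v^T *m v.
have QQ : Q *m Q = (2 * c) *: Q.
  by rewrite /Q mulmxA -(mulmxA v^T) vv mul_mx_scalar -scalemxAl.
have QT : Q^T = Q by rewrite /Q trmx_mul trmxK.
exists (1%:M - c^-1 *: Q).
  have -> : (1%:M - c^-1 *: Q)^T = 1%:M - c^-1 *: Q.
    by rewrite linearB/= trmx1 [X in _ - X]linearZ/= QT.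
  rewrite mulmxBl !mulmxBr !mul1mx mulmx1.
  rewrite -scalemxAl -scalemxAr QQ !scalerA.
  apply/matrixP => i j; rewrite !mxE.
  move: (Q i j) => q; field; exact: c0.
rewrite mulmxBr mulmx1 -scalemxAr /Q mulmxA.
have -> : e *m v^T = (- c)%:M.
  rewrite /v linearB/= mulmxBr eth ee; apply/matrixP => i j.
  by rewrite !ord1 !mxE eqxx !mulr1n /c opprB.
by rewrite mul_scalar_mx scalerA mulrN mulVf// scaleN1r opprK /v addrC subrK.
Qed.

Definition mutually_independent (R : realType) (d d' : measure_display)
    (T : measurableType d) (T' : measurableType d') (P : probability T R)
    (I : finType) (X : I -> T -> T') : Prop :=
  forall (J : {set I}) (A : I -> set T'), (forall i, measurable (A i)) ->
    P (\bigcap_(i in [set` J]) (X i @^-1` A i)) =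
    (\prod_(i in J) P (X i @^-1` A i))%E.

(* Main.v *)
Require Import Defs.
From mathcomp Require Import all_boot all_order all_algebra.
From mathcomp Require Import all_classical all_reals all_analysis.
From mathcomp Require Import measurable_realfun.
From mathcomp Require Import complex ring lra.
Set Implicit Arguments.
Unset Strict Implicit.
Unset Printing Implicit Defensive.
Import Order.TTheory GRing.Theory Num.Theory.
Import numFieldNormedType.Exports.
Local Open Scope classical_set_scope.
Local Open Scope ring_scope.

(** Why the theorem holds. For [x != 0] write [x = rho *: theta] with [theta] a
    unit vector. Since [K] is the intersection body of [L],
    [1 / ||x||_K = vol (L cap theta^perp) / rho], and this is, up to the factor
    [pi], the limit as [N] grows of
      [G_N x = int_L N / (1 + (N <x, y>)^2) dy]    ([cauchy_average]),
    because [N / (1 + (N u)^2)] is an approximate identity of mass [pi] and the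
    volume of the slices of [L] parallel to [theta^perp] is continuous at the
    central one. Moreover [G_N <= C / ||.||_K] with [C] independent of [N], since
    these volumes are bounded above, and those of the central slices are bounded
    away from zero ([cauchy_average_intersection_body]).

    The Cauchy kernel is a mixture of cosines:
    [1 / (1 + u^2) = int_0^oo exp (- s) cos (s u) ds]. By independence, and since
    the Fourier transform of [phi] is real, the expectation of the cosine of a
    linear form in [S_a = sum_i sqrt a_i X_i] is the product of the values of
    [phihat] at points proportional to the [sqrt a_i]. Hence [E G_N (S_a)] is an
    integral over [L x [0, +oo[], against a positive weight, of functions which
    are log-convex in [a] by hypothesis, and Hoelder's inequality makes it
    log-convex in [a] ([expectation_cauchy_average_log_convex]).

    It remains to let [N] grow ([geometric_mean_limit]): at the intermediate
    point Fatou's lemma suffices, and at the two end points either the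
    expectation is infinite and there is nothing to prove, or the bound by
    [C / ||.||_K] allows dominated convergence.

    The slicing of [L] uses the invariance of the Lebesgue measure under
    isometries; it is deduced from translation invariance by the uniqueness
    argument of Haar measure ([haar_mulmx]). *)

(** * Measurability on row vectors *)

Section measurability_rV.
Context {R : realType}.

Lemma measurable_ball_rV n (x : 'rV[R]_n) (e : R) :
  measurable (ball x e : set 'rV[R]_n).
Proof.
have [e0|e0] := leP e 0.
  rewrite (_ : ball x e = set0)//.
  by apply/seteqP; split => // y [] /=; rewrite ltNge e0.
rewrite (_ : ball x e = \bigcap_(i in [set: 'I_n])
    ((fun v : 'rV[R]_n => v ord0 i) @^-1` ball (x ord0 i) e)).
  apply: fin_bigcap_measurable => // i _.
  rewrite -[X in measurable X]setTI.
  by apply: measurable_coord => //; exact: measurable_ball.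
apply/seteqP; split => [y [_ xy] i _ /=|y xy]; first exact: xy.
by split => // i j; rewrite (ord1 i); exact: xy.
Qed.

(** Every open set is a countable union of boxes with rational centres. *)
Lemma open_measurable_rV n (U : set 'rV[R]_n) : open U -> measurable U.
Proof.
move=> oU.
pose D (qk : 'rV[rat]_n * nat) : set 'rV[R]_n :=
  ball (map_mx ratr qk.1 : 'rV[R]_n) qk.2.+1%:R^-1.
rewrite (_ : U = \bigcup_qk (if `[<D qk `<=` U>] then D qk else set0)).
  apply: countable_bigcupT_measurable => // qk; case: ifP => // _.
  exact: measurable_ball_rV.
apply/seteqP; split => [x Ux|x [qk _]]; last first.
  by case: ifP => // /asboolP DU /DU.
have /nbhs_ballP[e /= e0 xeU] : nbhs x U by exact: open_nbhs_nbhs.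
pose k := Num.truncn (e / 2)^-1.
have kE : k.+1%:R^-1 <= e / 2.
  rewrite -[e / 2]invrK lef_pV2 ?posrE ?invr_gt0 ?divr_gt0//.
  by rewrite ltW// truncnS_gt.
have hq (i : 'I_n) : {q : rat | ball (ratr q : R) k.+1%:R^-1 (x ord0 i)}.
  apply: cid; have : x ord0 i < x ord0 i + k.+1%:R^-1 by rewrite ltrDl.
  move=> /rat_in_itvoo[q /itvP qx]; exists q.
  rewrite /ball /= gtr0_norm ?subr_gt0 ?qx//.
  by rewrite ltrBlDl qx.
pose q : 'rV[rat]_n := \row_i sval (hq i).
exists (q, k) => //.
have Dx : D (q, k) x.
  split => // i j; rewrite !mxE (ord1 i); exact: (svalP (hq j)).
case: ifPn => [//|/asboolP]; case=> y Dy; apply: xeU.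
split => //.
move=> i j; have /(le_ball kE) := Dx.2 i j; have /(le_ball kE) := Dy.2 i j.
move=> /= yq /ball_sym xq.
by rewrite [e]splitr; exact: ball_triangle xq yq.
Qed.

Lemma closed_measurable_rV n (U : set 'rV[R]_n) : closed U -> measurable U.
Proof.
by move=> cU; rewrite -[U]setCK; apply: measurableC; apply: open_measurable_rV;
  exact: closed_openC.
Qed.

Lemma measurable_ereal_rV n (f : 'rV[R]_n -> \bar R) :
  (forall r : \bar R, open [set x | (f x < r)%E]) -> measurable_fun setT f.
Proof.
move=> fr; apply: (measurability _ (ErealGenInftyO.measurableE R)).
move=> _ -[_ [r ->] <-]; rewrite setTI.
rewrite (_ : _ @^-1` _ = [set x | (f x < r%:E)%E]).
  exact: open_measurable_rV.
by apply/seteqP; split => x /=; rewrite in_itv.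
Qed.

Lemma measurable_rVD d (T : measurableType d) n (f g : T -> 'rV[R]_n) :
  measurable_fun setT f -> measurable_fun setT g ->
  measurable_fun setT (fun x => f x + g x).
Proof.
move=> /measurable_fun_rVP mf /measurable_fun_rVP mg.
apply/measurable_fun_rVP => i; under eq_fun do rewrite mxE.
exact: measurable_funD.
Qed.

Lemma measurable_rVZ d (T : measurableType d) n (k : T -> R)
    (f : T -> 'rV[R]_n) : measurable_fun setT k -> measurable_fun setT f ->
  measurable_fun setT (fun x => k x *: f x).
Proof.
move=> mk /measurable_fun_rVP mf.
apply/measurable_fun_rVP => i; under eq_fun do rewrite mxE.
exact: measurable_funM.
Qed.

Lemma measurable_rV_sum d (T : measurableType d) n I (s : seq I)
    (f : I -> T -> 'rV[R]_n) :
  (forall i, measurable_fun setT (f i)) ->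
  measurable_fun setT (fun x => \sum_(i <- s) f i x).
Proof.
move=> mf; apply/measurable_fun_rVP => j.
under eq_fun do rewrite summxE.
apply: (@measurable_sum _ _ _ _ _ s (fun i x => f i x ord0 j)) => i.
exact: (measurable_fun_rVP _).1 (mf i) j.
Qed.

Lemma measurable_rV_mulmx d (T : measurableType d) m n (f : T -> 'rV[R]_m)
    (M : 'M[R]_(m, n)) : measurable_fun setT f ->
  measurable_fun setT (fun x => f x *m M).
Proof.
move=> /measurable_fun_rVP mf; apply/measurable_fun_rVP => j.
under eq_fun do rewrite mxE.
apply: (@measurable_sum _ _ _ _ _ _ (fun i x => f x ord0 i * M i j)) => i.
by apply: measurable_funM => //; exact: measurable_cst.
Qed.

Lemma measurable_dotp d (T : measurableType d) n (f g : T -> 'rV[R]_n) :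
  measurable_fun setT f -> measurable_fun setT g ->
  measurable_fun setT (fun x => dotp (f x) (g x)).
Proof.
move=> /measurable_fun_rVP mf /measurable_fun_rVP mg.
apply: (@measurable_sum _ _ _ _ _ _
  (fun i x => f x ord0 i * g x ord0 i)) => i.
exact: measurable_funM.
Qed.

End measurability_rV.

(** * Lebesgue measure on row vectors: translations and cubes *)

Section lebesgue_rV_theory.
Context {R : realType}.
Local Notation mu := (@lebesgue_measure R).

Lemma ge0_integral_lebesgue_shift (f : R -> \bar R) (a : R) :
  measurable_fun setT f -> (forall x, 0 <= f x)%E ->
  (\int[mu]_x f (x + a)%R = \int[mu]_x f x)%E.
Proof.
move=> mf f0.
pose T : measurableTypeR R -> measurableTypeR R := fun x => x + a.
have mT : measurable_fun setT T by exact: measurable_funD.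
pose nu : {measure set (measurableTypeR R) -> \bar R} :=
  measure_function_pushforward__canonical__measure_function_Measure mu mT.
transitivity (\int[nu]_x f x)%E.
  by rewrite ge0_integral_pushforward.
apply: eq_measure_integral => A mA _; apply/esym.
apply: lebesgue_measure_unique => // _ [[b c]] _ <-.
rewrite /nu/= /pushforward.
rewrite (_ : T @^-1` _ = `]b - a, c - a]%classic); last first.
  apply/seteqP; split => x /=; rewrite !in_itv/= /T.
    by rewrite ltrBlDr lerBrDr.
  by rewrite ltrBlDr lerBrDr.
rewrite !lebesgue_measure_itv/= !lte_fin ltrD2r.
by case: ifPn => // _; rewrite -!EFinD; congr EFin; ring.
Qed.

Lemma ge0_integral_rV_cons n (f : 'rV[R]_n.+1 -> \bar R) :
  measurable_fun setT f -> (forall x, 0 <= f x)%E ->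
  (\int[lebesgue_rV]_x f x =
   \int[mu]_r \int[lebesgue_rV]_z f (rV_cons (r, z)))%E.
Proof.
move=> mf f0.
pose m1 : {sigma_finite_measure set (measurableTypeR R) -> \bar R} := mu.
pose m2 : {sigma_finite_measure set 'rV[R]_n -> \bar R} := @lebesgue_rV R n.
transitivity (\int[(m1 \x m2)%E]_p f (rV_cons p))%E; last first.
  apply: fubini_tonelli1 => //.
  by apply: measurableT_comp => //; exact: measurable_rV_cons.
by rewrite -[RHS](@ge0_integral_pushforward _ _ _ _ _ _ (@measurable_rV_cons R n) (m1 \x m2)%E setT).
Qed.

Lemma rV_consD n (p q : measurableTypeR R * 'rV[R]_n) :
  rV_cons p + rV_cons q = rV_cons (p.1 + q.1 : measurableTypeR R, p.2 + q.2).
Proof.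
apply/rowP => i; rewrite mxE; have [j ->|->] := unliftP ord0 i.
  by rewrite !rV_consS mxE.
by rewrite !rV_cons0.
Qed.

Lemma ge0_integral_lebesgue_rV_shift n (f : 'rV[R]_n -> \bar R) (v : 'rV[R]_n) :
  measurable_fun setT f -> (forall x, 0 <= f x)%E ->
  (\int[lebesgue_rV]_x f (x + v)%R = \int[lebesgue_rV]_x f x)%E.
Proof.
elim: n f v => [|n IH] f v mf f0.
  by apply: eq_integral => x _; congr f; apply/rowP => -[].
have mshift : measurable_fun setT (fun x : 'rV[R]_n.+1 => x + v).
  by apply: measurable_rVD => //; exact: measurable_cst.
rewrite (ge0_integral_rV_cons (measurableT_comp mf mshift)); last first.
  by move=> x; exact: f0.
rewrite (ge0_integral_rV_cons mf f0).
have mcons r : measurable_fun setT (fun z : 'rV[R]_n => rV_cons (r, z)).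
  apply: (measurableT_comp (@measurable_rV_cons R n)).
  exact: pair1_measurable.
pose F (r : R) : \bar R := (\int[lebesgue_rV]_z f (rV_cons (r, z)))%E.
have mF : measurable_fun setT F.
  apply: (@measurable_fun_fubini_tonelli_F _ _ _ _ _ (@lebesgue_rV R n) (f \o @rV_cons R n)) => [|x]; last exact: f0.
  by apply: measurableT_comp => //; exact: measurable_rV_cons.
have [v1 ->] : exists p, v = rV_cons p by exists (rV_split v); rewrite rV_splitK.
transitivity (\int[mu]_r F (r + v1.1)%R)%E; last first.
  by rewrite ge0_integral_lebesgue_shift// => r; exact: integral_ge0.
apply: eq_integral => r _ /=.
under eq_integral do rewrite rV_consD/=.
rewrite (IH (fun z => f (rV_cons (r + v1.1 : measurableTypeR R, z))))//.
exact: measurableT_comp.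
Qed.

Lemma lebesgue_rV_cube n (s : R) : 0 <= s ->
  lebesgue_rV [set v : 'rV[R]_n | forall i, `|v ord0 i| <= s] =
  ((2 * s) ^+ n)%:E.
Proof.
move=> s0.
have -> : [set v : 'rV[R]_n | forall i, `|v ord0 i| <= s] =
    [set v | forall i, `[- s, s]%classic (v ord0 i)].
  apply/seteqP; split => v /= vs i; have := vs i; rewrite in_itv/=.
    by rewrite ler_norml.
  by rewrite ler_norml.
rewrite (lebesgue_rV_box (fun=> measurable_itv _)).
under eq_bigr do rewrite lebesgue_measure_itv/=.
rewrite (_ : (if _ then _ else _) = (2 * s)%:E); last first.
  have [ss|ss] := ltP (- s)%:E s%:E.
    by rewrite opprK -EFinD; congr EFin; ring.
  rewrite lee_fin in ss; congr EFin; have : s = 0 by lra.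
  by move=> ->; rewrite mulr0.
by rewrite prodEFin prodr_const card_ord.
Qed.

Lemma measurable_cube n (s : R) :
  measurable [set v : 'rV[R]_n | forall i, `|v ord0 i| <= s].
Proof.
rewrite (_ : [set v | _] = \bigcap_(i in [set: 'I_n])
    ((fun v : 'rV[R]_n => v ord0 i) @^-1` `[- s, s]%classic)).
  apply: fin_bigcap_measurable => // i _.
  rewrite -[X in measurable X]setTI.
  by apply: measurable_coord => //; exact: measurable_itv.
apply/seteqP; split => v /= vs i; have := vs i; rewrite /= in_itv/=.
  by rewrite ler_norml.
by move=> /(_ I); rewrite ler_norml.
Qed.

End lebesgue_rV_theory.

(** * Uniqueness of translation-invariant measures, isometries, dilations *)

Section change_of_variables_rV.
Context {R : realType}.

(** The uniqueness of the Haar measure, for the image of the Lebesgue measure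
    under an invertible matrix: both sides are the double integral of
    [f (x + y *m M) * g (y *m M)], computed by translating [x], respectively
    [y]. *)
Lemma haar_mulmx n (M : 'M[R]_n) (f g : 'rV[R]_n -> \bar R) :
  M \in unitmx ->
  measurable_fun setT f -> (forall x, 0 <= f x)%E ->
  measurable_fun setT g -> (forall x, 0 <= g x)%E ->
  ((\int[lebesgue_rV]_x f x) * (\int[lebesgue_rV]_x g (x *m M)) =
   (\int[lebesgue_rV]_x f (x *m M)) * (\int[lebesgue_rV]_x g (- x)%R))%E.
Proof.
move=> uM mf f0 mg g0.
pose m : {sigma_finite_measure set 'rV[R]_n -> \bar R} := @lebesgue_rV R n.
have mM : measurable_fun setT (fun x : 'rV[R]_n => x *m M).
  by apply: measurable_rV_mulmx; exact: measurable_id.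
have mgM : measurable_fun setT (fun x : 'rV[R]_n => g (x *m M)).
  exact: (measurableT_comp mg mM).
have mfM : measurable_fun setT (fun x : 'rV[R]_n => f (x *m M)).
  exact: (measurableT_comp mf mM).
have mN : measurable_fun setT (fun x : 'rV[R]_n => - x).
  under eq_fun do rewrite -scaleN1r.
  by apply: measurable_rVZ; [exact: measurable_cst|exact: measurable_id].
have mgN : measurable_fun setT (fun x : 'rV[R]_n => g (- x)).
  exact: (measurableT_comp mg mN).
have mfst : measurable_fun setT (fun p : 'rV[R]_n * 'rV[R]_n => p.1).
  exact: measurable_fst.
have msnd : measurable_fun setT (fun p : 'rV[R]_n * 'rV[R]_n => p.2).
  exact: measurable_snd.
have Fg0 : (0 <= \int[m]_x g (- x)%R)%E by apply: integral_ge0.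
transitivity (\int[m]_y \int[m]_x (f (x + y *m M)%R * g (y *m M)))%E.
  rewrite -ge0_integralZl//; last by apply: integral_ge0.
  apply: eq_integral => y _; rewrite ge0_integralZr//; last first.
    apply: (measurableT_comp mf).
    by apply: measurable_rVD; [exact: measurable_id|exact: measurable_cst].
  by rewrite ge0_integral_lebesgue_rV_shift.
transitivity (\int[m]_x \int[m]_y (f (x + y *m M)%R * g (y *m M)))%E.
  apply/esym.
  apply: (@fubini_tonelli _ _ _ _ _ m m
    (fun p => f (p.1 + p.2 *m M)%R * g (p.2 *m M))%E) => [|p]; last first.
    exact: mule_ge0.
  apply: emeasurable_funM.
    apply: (measurableT_comp mf).
    by apply: measurable_rVD => //; exact: measurable_rV_mulmx.
  by apply: (measurableT_comp mg); exact: measurable_rV_mulmx.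
transitivity (\int[m]_x \int[m]_y (f (y *m M)%R * g (y *m M - x)%R))%E.
  apply: eq_integral => x _.
  rewrite -(@ge0_integral_lebesgue_rV_shift _ _
     (fun y => f (y *m M)%R * g (y *m M - x)%R)%E (x *m invmx M)); last 2 first.
  - apply: emeasurable_funM => //; apply: (measurableT_comp mg).
    by apply: measurable_rVD => //; exact: measurable_cst.
  - by move=> y; exact: mule_ge0.
  apply: eq_integral => y _.
  by rewrite mulmxDl mulmxKV// addrK addrC.
transitivity (\int[m]_y \int[m]_x (f (y *m M)%R * g (y *m M - x)%R))%E.
  apply: (@fubini_tonelli _ _ _ _ _ m m
    (fun p => f (p.2 *m M)%R * g (p.2 *m M - p.1)%R)%E) => [|p]; last first.
    exact: mule_ge0.
  apply: emeasurable_funM.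
    by apply: (measurableT_comp mf); exact: measurable_rV_mulmx.
  apply: (measurableT_comp mg); apply: measurable_rVD.
    exact: measurable_rV_mulmx.
  exact: (measurableT_comp mN).
rewrite -ge0_integralZr//.
apply: eq_integral => y _.
rewrite ge0_integralZl//; last first.
  by apply: (measurableT_comp mg); apply: measurable_rVD.
congr (_ * _)%E.
rewrite -(@ge0_integral_lebesgue_rV_shift _ _
     (fun x => g (- x)%R)%E (- (y *m M)))//.
by apply: eq_integral => x _; rewrite opprB.
Qed.

Lemma lebesgue_rV_le_cube n (s : R) (A : set 'rV[R]_n) : measurable A -> 0 <= s ->
  (forall v, A v -> forall i, `|v ord0 i| <= s) ->
  (lebesgue_rV A <= ((2 * s) ^+ n)%:E)%E.
Proof.
move=> mA s0 As; rewrite -lebesgue_rV_cube//; apply: le_measure => //.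
- by rewrite inE.
- by rewrite inE; exact: measurable_cube.
Qed.

Lemma lebesgue_rV_ge_cube n (s : R) (A : set 'rV[R]_n) : measurable A -> 0 <= s ->
  (forall v : 'rV[R]_n, (forall i, `|v ord0 i| <= s) -> A v) ->
  (((2 * s) ^+ n)%:E <= lebesgue_rV A)%E.
Proof.
move=> mA s0 As; rewrite -lebesgue_rV_cube//; apply: le_measure => //.
- by rewrite inE; exact: measurable_cube.
- by rewrite inE.
Qed.

Lemma dotp_ge0 n (x : 'rV[R]_n) : 0 <= dotp x x.
Proof. by apply: sumr_ge0 => i _; rewrite -expr2 sqr_ge0. Qed.

Lemma dotpC n (x y : 'rV[R]_n) : dotp x y = dotp y x.
Proof. by apply: eq_bigr => i _; rewrite mulrC. Qed.

Lemma dotp_mulmx n (x y : 'rV[R]_n) : x *m y^T = (dotp x y)%:M.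
Proof.
apply/matrixP => i j; rewrite !ord1 !mxE eqxx mulr1n.
by apply: eq_bigr => k _; rewrite mxE.
Qed.

Lemma dotpE n (x y : 'rV[R]_n) : dotp x y = (x *m y^T) ord0 ord0.
Proof. by rewrite dotp_mulmx mxE eqxx mulr1n. Qed.

Lemma le_coord_enorm n (x : 'rV[R]_n) i : `|x ord0 i| <= enorm x.
Proof.
rewrite -sqrtr_sqr ler_sqrt ?dotp_ge0// /dotp (bigD1 i)//= -expr2 lerDl.
by apply: sumr_ge0 => j _; rewrite -expr2 sqr_ge0.
Qed.

Lemma enorm_le_cube n (x : 'rV[R]_n) (s : R) : 0 <= s ->
  (forall i, `|x ord0 i| <= s) -> enorm x <= n%:R * s.
Proof.
move=> s0 xs; rewrite -[leRHS]ger0_norm ?mulr_ge0// -sqrtr_sqr ler_sqrt ?sqr_ge0//.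
apply: (@le_trans _ _ (\sum_(i < n) s ^+ 2)).
  apply: ler_sum => i _; rewrite -expr2 -[x _ _ ^+ 2]ger0_norm ?sqr_ge0//.
  by rewrite normrX lerXn2r// nnegrE.
rewrite sumr_const card_ord -[leLHS]mulr_natl exprMn.
apply: ler_wpM2r; first exact: sqr_ge0.
by rewrite -natrX ler_nat; case: n {x xs} => // n; rewrite expnS expn1 leq_pmulr.
Qed.

(* A set of positive finite measure which isometries preserve. *)
Let eball n : set 'rV[R]_n := [set x | dotp x x <= 1].
Arguments eball : clear implicits.

Let measurable_eball n : measurable (eball n).
Proof.
rewrite -[X in measurable X]setTI; apply: measurable_fun_le => //.
  by apply: measurable_dotp; exact: measurable_id.
Qed.

Let eball_gt0 n : (0 < lebesgue_rV (eball n))%E.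
Proof.
apply: (@lt_le_trans _ _ (((2 * n.+1%:R^-1 : R) ^+ n)%:E)).
  by rewrite lte_fin exprn_gt0.
apply: lebesgue_rV_ge_cube => // v vs.
have := @enorm_le_cube _ v n.+1%:R^-1 ltac:(by []) vs.
have vn1 : n%:R * n.+1%:R^-1 <= 1 :> R by rewrite ler_pdivrMr// mul1r ler_nat.
move=> /le_trans/(_ vn1); rewrite -[1 in X in X -> _]sqrtr1 ler_sqrt//.
Qed.

Let eball_lty n : (lebesgue_rV (eball n) < +oo)%E.
Proof.
apply: (@le_lt_trans _ _ ((2 * 1 : R) ^+ n)%:E); last exact: ltry.
apply: lebesgue_rV_le_cube => // v vs i; apply: le_trans (le_coord_enorm _ _) _.
by rewrite -sqrtr1 ler_sqrt.
Qed.

Let measurable_eindic n (B : set 'rV[R]_n) : measurable B ->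
  measurable_fun setT (fun x : 'rV[R]_n => (\1_B x : R)%:E).
Proof. by move=> mB; apply/measurable_EFinP; exact: measurable_indic. Qed.

Let eindic_ge0 n (B : set 'rV[R]_n) x : (0 <= (\1_B x : R)%:E)%E.
Proof. by rewrite lee_fin. Qed.

Let integral_eindic n (B : set 'rV[R]_n) : measurable B ->
  (\int[lebesgue_rV]_x (\1_B x : R)%:E = lebesgue_rV B)%E.
Proof. by move=> mB; rewrite integral_indic// setIT. Qed.

(** Testing [haar_mulmx] on the Euclidean unit ball, which [Q] preserves, leaves
    no constant; the reflection [x |-> - x] is the case of the identity matrix. *)
Lemma ge0_integral_lebesgue_rV_isometry n (Q : 'M[R]_n) (g : 'rV[R]_n -> \bar R) :
  Q *m Q^T = 1%:M ->
  measurable_fun setT g -> (forall x, 0 <= g x)%E ->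
  (\int[lebesgue_rV]_x g (x *m Q) = \int[lebesgue_rV]_x g x)%E.
Proof.
have H (M : 'M[R]_n) (h : 'rV[R]_n -> \bar R) : M *m M^T = 1%:M ->
  measurable_fun setT h -> (forall x, 0 <= h x)%E ->
  (\int[lebesgue_rV]_x h (x *m M) = \int[lebesgue_rV]_x h (- x)%R)%E.
  move=> MM mh h0.
  have uM : M \in unitmx by have [] := mulmx1_unit MM.
  have eM x : (\1_(eball n) (x *m M) : R) = \1_(eball n) x.
    rewrite !indicE; congr (nat_of_bool _)%:R.
    by apply/idP/idP; rewrite !inE /eball/= !dotpE trmx_mul mulmxA -(mulmxA x) MM mulmx1.
  have := haar_mulmx uM (measurable_eindic (@measurable_eball n)) (@eindic_ge0 _ _) mh h0.
  have -> : (\int[lebesgue_rV]_x (\1_(eball n) (x *m M) : R)%:E =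
             \int[lebesgue_rV]_x (\1_(eball n) x : R)%:E)%E.
    by apply: eq_integral => x _; rewrite eM.
  rewrite integral_eindic//.
  have fin : lebesgue_rV (eball n) \is a fin_num by rewrite ge0_fin_numE.
  move=> hh; apply/eqP; rewrite eq_le.
  by rewrite -(lee_pmul2l fin)// hh lexx -(lee_pmul2l fin)// hh lexx.
move=> QQ mg g0; rewrite H// -(H 1%:M) ?trmx1 ?mulmx1//.
by apply: eq_integral => x _; rewrite mulmx1.
Qed.

Lemma lebesgue_rV_null_scale n (t : R) (A : set 'rV[R]_n) : t != 0 ->
  measurable A -> lebesgue_rV A = 0%E ->
  lebesgue_rV [set x | A (t *: x)] = 0%E.
Proof.
move=> t0 mA A0.
have uM : (t%:M : 'M[R]_n) \in unitmx.
  by rewrite unitmxE det_scalar unitrX ?unitfE.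
have mAt : measurable [set x | A (t *: x)].
  by rewrite -[X in measurable X]setTI; apply: measurable_rVZ.
have := haar_mulmx uM (measurable_eindic (@measurable_eball n)) (@eindic_ge0 _ _)
  (measurable_eindic mA) (@eindic_ge0 _ _).
have -> : (\int[lebesgue_rV]_x (\1_A (- x) : R)%:E =
           \int[lebesgue_rV]_x (\1_A x : R)%:E)%E.
  rewrite -(@ge0_integral_lebesgue_rV_isometry _ (- 1%:M)
    (fun x => (\1_A x)%:E))//; last 2 first.
  - by rewrite raddfN/= trmx1 mulmxN mulNmx mulmx1 opprK.
  - exact: measurable_eindic.
  by apply: eq_integral => x _; rewrite mulmxN mulmx1.
have -> : (\int[lebesgue_rV]_x (\1_A (x *m t%:M) : R)%:E =
           \int[lebesgue_rV]_x (\1_[set x | A (t *: x)] x : R)%:E)%E.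
  apply: eq_integral => x _; rewrite mul_mx_scalar !indicE.
  by congr (nat_of_bool _)%:R%:E; apply/idP/idP; rewrite !inE.
rewrite (integral_eindic mA) (integral_eindic mAt) A0 mule0.
rewrite (integral_eindic (@measurable_eball n)).
by move=> /eqP; rewrite mule_eq0 (gt_eqF (eball_gt0 n))//= => /eqP.
Qed.

End change_of_variables_rV.

(** * Slicing along a hyperplane *)

Section slices.
Context {R : realType}.
Local Notation mu := (@lebesgue_measure R).

Lemma ge0_integral_lebesgue_scale (f : R -> \bar R) (c : R) : 0 < c ->
  measurable_fun setT f -> (forall x, 0 <= f x)%E ->
  (\int[mu]_x (c%:E * f (c * x)%R) = \int[mu]_x f x)%E.
Proof.
move=> c0 mf f0.
pose T : measurableTypeR R -> measurableTypeR R := fun x => c * x.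
have mT : measurable_fun setT T by exact: measurable_funM.
pose nu : {measure set (measurableTypeR R) -> \bar R} :=
  measure_function_pushforward__canonical__measure_function_Measure mu mT.
pose nuc : {measure set (measurableTypeR R) -> \bar R} :=
  mscale (NngNum (ltW c0)) nu.
transitivity (\int[nuc]_x f x)%E.
  rewrite ge0_integral_mscale// ge0_integral_pushforward//.
  by rewrite ge0_integralZl//; [exact: (measurableT_comp mf mT)|rewrite lee_fin ltW].
apply: eq_measure_integral => A mA _; apply/esym.
apply: lebesgue_measure_unique => // _ [[a b]] _ <-.
rewrite /nuc/= /mscale/= /nu/= /pushforward.
have -> : T @^-1` `]a, b]%classic = `]c^-1 * a, c^-1 * b]%classic.
  apply/seteqP; split => x /=; rewrite !in_itv/= /T.
    by rewrite ltr_pdivrMl// ler_pdivlMl.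
  by rewrite ltr_pdivrMl// ler_pdivlMl.
rewrite !lebesgue_measure_itv/= !lte_fin ltr_pM2l ?invr_gt0//.
case: ifPn => _; last by rewrite mule0.
by rewrite -!EFinD -EFinM; congr EFin; rewrite mulrDr mulrN !mulrA mulfV ?gt_eqF// !mul1r.
Qed.

Lemma rV_cons_mul_col_mx m n (p : measurableTypeR R * 'rV[R]_m) (theta : 'rV[R]_n) (B : 'M[R]_(m, n)) :
  rV_cons p *m (col_mx theta B : 'M[R]_(m.+1, n)) = p.1 *: theta + p.2 *m B.
Proof.
by apply: etrans (mul_row_col (p.1)%:M p.2 theta B) _; rewrite mul_scalar_mx.
Qed.

Lemma orthonormal_frame_mulmx_tr m (theta : 'rV[R]_m.+1) (B : 'M[R]_(m, m.+1)) :
  enorm theta = 1 -> orthonormal_frame theta B ->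
  (col_mx theta B : 'M[R]_(m.+1)) *m (col_mx theta B : 'M[R]_(m.+1))^T = 1%:M.
Proof.
move=> th1 [BB Bth].
have thth : theta *m theta^T = 1%:M.
  rewrite dotp_mulmx; congr (_%:M); rewrite -[RHS](expr1n _ 2) -th1 sqr_sqrtr//.
  exact: dotp_ge0.
have thB : theta *m B^T = 0 by rewrite -[RHS]trmx0 -Bth trmx_mul trmxK.
change ((col_mx theta B : 'M[R]_(1 + m, m.+1)) *m (col_mx theta B)^T = 1%:M).
by rewrite tr_col_mx mul_col_row thth thB BB Bth -scalar_mx_block.
Qed.

(** Fubini in an orthonormal basis made of [theta] and of the rows of [B]. *)
Lemma ge0_integral_slices m (theta : 'rV[R]_m.+1) (B : 'M[R]_(m, m.+1))
    (g : 'rV[R]_m.+1 -> \bar R) :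
  enorm theta = 1 -> orthonormal_frame theta B ->
  measurable_fun setT g -> (forall x, 0 <= g x)%E ->
  (\int[lebesgue_rV]_y g y =
   \int[mu]_r \int[lebesgue_rV]_z g (r *: theta + z *m B)%R)%E.
Proof.
move=> th1 oB mg g0.
rewrite -(ge0_integral_lebesgue_rV_isometry (orthonormal_frame_mulmx_tr th1 oB))//.
have mQ : measurable_fun setT
    (fun x : 'rV[R]_m.+1 => x *m (col_mx theta B : 'M[R]_(m.+1))).
  by apply: measurable_rV_mulmx; exact: measurable_id.
rewrite (ge0_integral_rV_cons (measurableT_comp mg mQ)); last first.
  by move=> x; exact: g0.
apply: eq_integral => r _; apply: eq_integral => z _.
by rewrite /= rV_cons_mul_col_mx.
Qed.

End slices.

(** * Minkowski functionals and star bodies *)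

Section minkowski.
Context {R : realType} {d : nat}.
Implicit Types (K L : set 'rV[R]_d) (x : 'rV[R]_d).

Lemma minkowski_functional_ge0 K x : (0 <= minkowski_functional K x)%E.
Proof. by apply: le_ereal_inf_tmp => _ [l [l0 _] <-]; rewrite lee_fin ltW. Qed.

Lemma minkowski_functional_le K x (l : R) : 0 < l -> K (l^-1 *: x) ->
  (minkowski_functional K x <= l%:E)%E.
Proof.
move=> l0 Kx; apply: ereal_inf_lbound; exists l => //; split => //.
by exists (l^-1 *: x) => //; rewrite scalerA mulfV ?gt_eqF// scale1r.
Qed.

Lemma minkowski_functionalZ K x (t : R) : 0 < t ->
  minkowski_functional K (t *: x) = (t%:E * minkowski_functional K x)%E.
Proof.
move=> t0.
have H (s : R) y : 0 < s ->
    (minkowski_functional K (s *: y) <= s%:E * minkowski_functional K y)%E.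
  move=> s0; rewrite -lee_pdivrMl//; apply: le_ereal_inf_tmp => _ [l [l0 [z Kz zy]] <-].
  rewrite lee_pdivrMl// -EFinM; apply: minkowski_functional_le.
    exact: mulr_gt0.
  by rewrite -zy !scalerA [X in X *: _](_ : _ = 1) ?scale1r//; field; rewrite !gt_eqF.
apply/eqP; rewrite eq_le H//=.
rewrite -lee_pdivlMl//; apply: le_trans (H _ _ _); last by rewrite invr_gt0.
by rewrite scalerA mulVf ?gt_eqF// scale1r.
Qed.

Lemma minkowski_functional_lt1 K x : star_body K ->
  (minkowski_functional K x < 1)%E -> K x.
Proof.
move=> [_ sK _ _] /ereal_inf_lt[_ [l [l0 [y Ky <-]] <-]].
by rewrite lte_fin => l1; apply: sK => //; rewrite !ltW.
Qed.

Lemma minkowski_functional_le1 K x : K x -> (minkowski_functional K x <= 1)%E.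
Proof. by move=> Kx; apply: minkowski_functional_le => //; rewrite invr1 scale1r. Qed.

Lemma star_body0 K : star_body K -> K 0.
Proof.
move=> [_ sK fK _]; have := fK 0; rewrite ge0_fin_numE ?minkowski_functional_ge0//.
move=> /ereal_inf_lt[_ [l [l0 [y Ky _]] _] _].
by rewrite -(scale0r y); apply: sK => //; rewrite lexx ler01.
Qed.

Lemma minkowski_functional0 K : star_body K -> minkowski_functional K 0 = 0%E.
Proof.
move=> /star_body0 K0; apply/eqP; rewrite eq_le minkowski_functional_ge0 andbT.
by apply/lee_addgt0Pr => e e0; rewrite add0e; apply: minkowski_functional_le => //; rewrite scaler0.
Qed.

Lemma star_body_measurable K : star_body K -> measurable K.
Proof.
by move=> [cK _ _ _]; apply: closed_measurable_rV; exact: compact_closed.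
Qed.

Lemma star_body_bounded K : star_body K ->
  exists2 s : R, 0 < s & forall x, K x -> forall i, `|x ord0 i| <= s.
Proof.
move=> [cK _ _ _].
have [M [Mr HM]] := compact_bounded cK.
exists (`|M| + 1) => [|x Kx i]; first by rewrite ltr_wpDl.
apply: (@le_trans _ _ `|x|); last first.
  by apply: HM => //; rewrite (le_lt_trans (ler_norm _))// ltrDl.
rewrite /Num.norm/= mx_normrE.
by apply: (le_bigmax _ (fun ij => `|x ij.1 ij.2|) (ord0, i)).
Qed.

Lemma star_body_open_lt K (r : \bar R) : star_body K ->
  open [set x | (minkowski_functional K x < r)%E].
Proof.
move=> [_ _ _ cK].
rewrite (_ : [set x | _] = minkowski_functional K @^-1` [set y | (y < r)%E])//.
move/continuousP : cK; apply; exact: open_ereal_lt_ereal.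
Qed.

Lemma star_body_cube K : star_body K ->
  exists2 s : R, 0 < s & forall x, (forall i, `|x ord0 i| <= s) -> K x.
Proof.
move=> sK.
have : nbhs (0 : 'rV[R]_d) [set x | (minkowski_functional K x < 1)%E].
  apply: open_nbhs_nbhs; split; first exact: star_body_open_lt.
  by rewrite /= minkowski_functional0.
move=> /nbhs_ballP[e /= e0 eK]; exists (e / 2); first by rewrite divr_gt0.
move=> x xe; apply: minkowski_functional_lt1 => //; apply: eK; split => // i j.
rewrite (ord1 i) /ball/= mxE sub0r normrN (le_lt_trans (xe j))//.
by rewrite ltr_pdivrMr// ltr_pMr// ltr1n.
Qed.

Lemma measurable_minkowski_functional K : star_body K ->
  measurable_fun setT (minkowski_functional K).
Proof.
by move=> sK; apply: measurable_ereal_rV => r; exact: star_body_open_lt.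
Qed.

End minkowski.

(** * Volumes of parallel slices and averages of the Cauchy kernel *)

Section slice_volume.
Context {R : realType} {m : nat}.
Local Notation mu := (@lebesgue_measure R).
Implicit Types (theta : 'rV[R]_m.+1) (B : 'M[R]_(m, m.+1)) (L : set 'rV[R]_m.+1).

Lemma orthonormal_frame_entry theta B i j :
  orthonormal_frame theta B -> `|B i j| <= 1.
Proof.
move=> [BB _]; rewrite -(@ler_pXn2r _ 2)// ?nnegrE// expr1n -normrX.
rewrite ger0_norm ?sqr_ge0//.
have <- : \sum_k B i k * B^T k i = 1.
  by have := congr1 (fun M : 'M[R]_m => M i i) BB; rewrite !mxE eqxx.
rewrite (bigD1 j)//= mxE -expr2 lerDl.
by apply: sumr_ge0 => k _; rewrite mxE -expr2 sqr_ge0.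
Qed.

Lemma frame_coordinates theta B (r : R) z : orthonormal_frame theta B ->
  (r *: theta + z *m B) *m B^T = z.
Proof.
move=> [BB Bth]; rewrite mulmxDl -mulmxA BB mulmx1 -scalemxAl.
by rewrite (_ : theta *m B^T = 0) ?scaler0 ?add0r// -[RHS]trmx0 -Bth trmx_mul trmxK.
Qed.

Lemma mulmx_le_cube (p q : nat) (x : 'rV[R]_p) (M : 'M[R]_(p, q)) (s : R) :
  0 <= s -> (forall i j, `|M i j| <= 1) -> (forall i, `|x ord0 i| <= s) ->
  forall j, `|(x *m M) ord0 j| <= p%:R * s.
Proof.
move=> s0 M1 xs j; rewrite mxE; apply: le_trans (ler_norm_sum _ _ _) _.
apply: (@le_trans _ _ (\sum_(i < p) s)); last by rewrite sumr_const card_ord mulr_natl.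
by apply: ler_sum => i _; rewrite normrM -[leRHS]mulr1; exact: ler_pM.
Qed.

(** The volume of the slice of [L] at signed distance [r] from the hyperplane
    orthogonal to [theta], read in the basis of this hyperplane formed by the
    rows of [B]. *)
Definition slice_volume L theta B (r : R) : \bar R :=
  lebesgue_rV [set z : 'rV[R]_m | L (r *: theta + z *m B)].

Lemma measurable_slice_param theta B :
  measurable_fun setT (fun p : measurableTypeR R * 'rV[R]_m => p.1 *: theta + p.2 *m B).
Proof.
apply: measurable_rVD; last by apply: measurable_rV_mulmx; exact: measurable_snd.
by apply: measurable_rVZ; [exact: measurable_fst|exact: measurable_cst].
Qed.

Lemma measurable_slice theta B (r : R) :
  measurable_fun setT (fun z : 'rV[R]_m => r *: theta + z *m B).
Proof.
exact: (measurableT_comp (measurable_slice_param theta B) (@pair1_measurable _ _ _ _ r)).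
Qed.

Lemma measurable_slice_set L theta B (r : R) : measurable L ->
  measurable [set z : 'rV[R]_m | L (r *: theta + z *m B)].
Proof.
by move=> mL; rewrite -[X in measurable X]setTI; exact: measurable_slice.
Qed.

Lemma integral_indic_slice L theta B (r : R) : measurable L ->
  (\int[lebesgue_rV]_z (\1_L (r *: theta + z *m B) : R)%:E = slice_volume L theta B r)%E.
Proof.
move=> mL.
have := @integral_indic _ _ R (@lebesgue_rV R m) setT measurableT
  [set z | L (r *: theta + z *m B)] (measurable_slice_set theta B r mL).
by rewrite setIT.
Qed.

Lemma measurable_slice_volume L theta B : measurable L ->
  measurable_fun setT (slice_volume L theta B).
Proof.
move=> mL; rewrite (_ : slice_volume L theta B = fun r : measurableTypeR R =>
    (\int[lebesgue_rV]_z (\1_L (r *: theta + z *m B) : R)%:E)%E); last first.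
  by apply/funext => r; rewrite integral_indic_slice.
apply: (@measurable_fun_fubini_tonelli_F _ _ _ _ _ (@lebesgue_rV R m)
  (fun p : measurableTypeR R * 'rV[R]_m => (\1_L (p.1 *: theta + p.2 *m B) : R)%:E)).
  apply/measurable_EFinP; apply: (measurableT_comp _ (measurable_slice_param theta B)).
  exact: measurable_indic.
by move=> p; rewrite lee_fin.
Qed.

Lemma slice_volume_le L : star_body L -> exists2 M : R, 0 < M &
  forall theta B r, orthonormal_frame theta B -> (slice_volume L theta B r <= M%:E)%E.
Proof.
move=> sL; have [s s0 Ls] := star_body_bounded sL.
exists ((2 * (m.+1%:R * s)) ^+ m); first by rewrite exprn_gt0// !mulr_gt0.
move=> theta B r oB; apply: lebesgue_rV_le_cube.
- by apply: measurable_slice_set; exact: star_body_measurable.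
- by rewrite mulr_ge0// ltW.
- move=> z Lz i; rewrite -(frame_coordinates r z oB).
  apply: mulmx_le_cube; [exact: ltW| |exact: Ls].
  by move=> j k; rewrite mxE; exact: orthonormal_frame_entry oB.
Qed.

Lemma slice_volume_ge L : star_body L -> exists2 c : R, 0 < c &
  forall theta B, orthonormal_frame theta B -> (c%:E <= slice_volume L theta B 0)%E.
Proof.
move=> sL; have [s s0 Ls] := star_body_cube sL.
exists ((2 * (s / m.+1%:R)) ^+ m); first by rewrite exprn_gt0// mulr_gt0// divr_gt0.
move=> theta B oB; apply: lebesgue_rV_ge_cube.
- by apply: measurable_slice_set; exact: star_body_measurable.
- by rewrite divr_ge0// ltW.
- move=> z zs /=; rewrite scale0r add0r; apply: Ls => i.
  apply: (@le_trans _ _ (m%:R * (s / m.+1%:R))).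
    apply: mulmx_le_cube => //; first by rewrite divr_ge0// ltW.
    by move=> j k; exact: orthonormal_frame_entry oB.
  by rewrite mulrCA ler_piMr ?(ltW s0)// ler_pdivrMr// mul1r ler_nat.
Qed.

(** The relative boundary of the central slice is null: the dilates of the level
    set at height 1 are the level sets at the other positive heights, and by
    Tonelli almost all of those are null. *)
Lemma slice_boundary_null L B : star_body L ->
  lebesgue_rV [set z : 'rV[R]_m | minkowski_functional L (z *m B) = 1%E] = 0%E.
Proof.
move=> sL.
pose h (z : 'rV[R]_m) : R := fine (minkowski_functional L (z *m B)).
have hE z : minkowski_functional L (z *m B) = (h z)%:E.
  by rewrite fineK//; case: sL => _ _ + _; apply.
have mh : measurable_fun setT h.
  apply/measurable_EFinP; rewrite (_ : EFin \o h =
    fun z => minkowski_functional L (z *m B)); last first.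
    by apply/funext => z; rewrite hE.
  apply: (measurableT_comp (measurable_minkowski_functional sL)).
  by apply: measurable_rV_mulmx; exact: measurable_id.
pose D : set (measurableTypeR R * 'rV[R]_m) := [set p | h p.2 = p.1].
have mD : measurable D.
  rewrite (_ : D = (fun p => h p.2 - p.1) @^-1` [set 0]); last first.
    by apply/seteqP; split => p /=; rewrite /D/= => /eqP hp; apply/eqP; rewrite subr_eq0 in hp *.
  rewrite -[X in measurable X]setTI; apply: measurable_funB => //.
  by apply: (measurableT_comp mh); exact: measurable_snd.
pose N (s : R) := [set z : 'rV[R]_m | h z = s].
have mN s : measurable (N s).
  by rewrite -[X in measurable X]setTI; apply: (mh measurableT [set s]).
have ND s z : \1_D (s, z) = \1_(N s) z :> R.
  by rewrite !indicE; congr (nat_of_bool _)%:R; apply/idP/idP; rewrite !inE.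
have mND : measurable_fun setT (fun p : measurableTypeR R * 'rV[R]_m => (\1_D p : R)%:E).
  by apply/measurable_EFinP; exact: measurable_indic.
have FE (s : measurableTypeR R) :
    lebesgue_rV (N s) = (\int[lebesgue_rV]_z (\1_D (s, z) : R)%:E)%E.
  by under eq_integral do rewrite ND; rewrite integral_indic// setIT.
have I0 : (\int[mu]_s lebesgue_rV (N s) = 0)%E.
  under eq_integral do rewrite FE.
  have := @fubini_tonelli _ _ _ _ _ mu (@lebesgue_rV R m)
    (fun p : measurableTypeR R * 'rV[R]_m => (\1_D p : R)%:E) mND.
  rewrite /fubini_F /fubini_G => ->; last by move=> p; rewrite lee_fin.
  apply: integral0_eq => z _.
  transitivity (\int[mu]_s (\1_[set h z] s : R)%:E)%E.
    apply: eq_integral => s _; rewrite !indicE; congr (nat_of_bool _)%:R%:E.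
    by apply/idP/idP; rewrite !inE.
  have := @integral_indic _ _ R mu setT measurableT [set h z] (measurable_set1 _).
  by rewrite setIT => ->; exact: lebesgue_measure_set1.
have -> : [set z : 'rV[R]_m | minkowski_functional L (z *m B) = 1%E] = N 1.
  by apply/seteqP; split => z /=; rewrite hE /N/=; [move=> []|move=> ->].
apply/eqP; apply/negP => /negP N1.
have N0 s : 0 < s -> lebesgue_rV (N s) != 0%E.
  move=> s0; apply: contra N1 => /eqP Ns; apply/eqP.
  rewrite -[RHS](lebesgue_rV_null_scale (lt0r_neq0 s0) (mN s) Ns).
  congr (lebesgue_rV _); apply/seteqP; split => z; rewrite /N/= /h -scalemxAl minkowski_functionalZ// hE/=.
    by move=> ->; rewrite mulr1.
  by move=> /eqP; rewrite -[X in _ == X]mulr1 (inj_eq (mulfI (lt0r_neq0 s0))) => /eqP.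
have : ae_eq mu setT (fun s => lebesgue_rV (N s)) (cst 0%E).
  apply/ae_eq_integral_abs => //.
    under eq_fun do rewrite FE.
    apply: (@measurable_fun_fubini_tonelli_F _ _ _ _ _ (@lebesgue_rV R m)
      (fun p : measurableTypeR R * 'rV[R]_m => (\1_D p : R)%:E)) => //.
  by under eq_integral do rewrite gee0_abs//.
move=> [A [mA A0 sA]].
have : (mu `]0%R, 1%R[ <= mu A)%E.
  apply: le_measure; rewrite ?inE// => s /=; rewrite in_itv/= => /andP[s0 _].
  by apply: sA => /= /(_ I) /eqP; apply/negP; exact: N0.
by rewrite A0 lebesgue_measure_itv/= lte_fin ltr01 oppr0 adde0 lee_fin ler10.
Qed.

(** The indicator of [L] is continuous off the boundary of [L], whose trace on
    the central slice is null; dominated convergence concludes. *)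
Lemma cvg_slice_volume L theta B (r_ : nat -> R) : star_body L ->
  orthonormal_frame theta B -> r_ @ \oo --> (0 : R) ->
  slice_volume L theta B (r_ n) @[n --> \oo] --> slice_volume L theta B 0.
Proof.
move=> sL oB r0; have mL := star_body_measurable sL.
have [s s0 Ls] := star_body_bounded sL.
pose C := [set z : 'rV[R]_m | forall i, `|z ord0 i| <= m.+1%:R * s].
have mC : measurable C by exact: measurable_cube.
have mI (A : set 'rV[R]_m) : measurable A ->
    measurable_fun setT (fun z : 'rV[R]_m => (\1_A z : R)%:E).
  by move=> mA; apply/measurable_EFinP; exact: measurable_indic.
have mf r : measurable_fun setT (fun z : 'rV[R]_m => (\1_L (r *: theta + z *m B) : R)%:E).
  exact: (mI _ (measurable_slice_set theta B r mL)).
pose f_ n (z : 'rV[R]_m) : \bar R := (\1_L (r_ n *: theta + z *m B) : R)%:E.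
pose f (z : 'rV[R]_m) : \bar R := (\1_L (0 *: theta + z *m B) : R)%:E.
have ae1 : {ae @lebesgue_rV R m, forall z, setT z -> f_ ^~ z @ \oo --> f z}.
  exists [set z : 'rV[R]_m | minkowski_functional L (z *m B) = 1%E]; split.
  - have mg : measurable_fun setT (fun z : 'rV[R]_m => minkowski_functional L (z *m B)).
      apply: (measurableT_comp (measurable_minkowski_functional sL)).
      by apply: measurable_rV_mulmx; exact: measurable_id.
    by have := mg measurableT _ (emeasurable_set1 1%E); rewrite setTI.
  - exact: slice_boundary_null.
  - move=> z; apply: contra_notP => z1 _; rewrite /f_ /f scale0r add0r.
    have cv : (r_ n *: theta + z *m B) @[n --> \oo] --> z *m B.
      rewrite -[X in _ --> X]add0r; apply: cvgD; last exact: cvg_cst.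
      by rewrite -(scale0r theta); apply: cvgZr_tmp.
    have [Lz|Lz] := pselect (L (z *m B)).
      have : (minkowski_functional L (z *m B) < 1)%E.
        by rewrite lt_neqAle minkowski_functional_le1// andbT; apply/eqP.
      move=> zlt; rewrite [X in _ --> (X%:E)](_ : _ = 1); last by rewrite indicE mem_set.
      apply: cvg_near_cst.
      have : \forall n \near \oo,
          (minkowski_functional L (r_ n *: theta + z *m B) < 1)%E.
        exact: (cv _ (open_nbhs_nbhs (conj (star_body_open_lt sL) zlt))).
      apply: filterS => n /= /(minkowski_functional_lt1 sL) Ln.
      by rewrite indicE mem_set.
    rewrite [X in _ --> (X%:E)](_ : _ = 0); last by rewrite indicE memNset.
    apply: cvg_near_cst.
    have oLC : open (~` L).
      by apply: closed_openC; case: (sL) => cL _ _ _; exact: compact_closed.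
    have : \forall n \near \oo, (~` L) (r_ n *: theta + z *m B).
      exact: (cv _ (open_nbhs_nbhs (conj oLC Lz))).
    by apply: filterS => n /= Ln; rewrite indicE memNset.
have ae2 : {ae @lebesgue_rV R m, forall z n, setT z -> (`|f_ n z| <= (\1_C z : R)%:E)%E}.
  apply: aeW => z n _; rewrite /f_ gee0_abs ?lee_fin// !indicE.
  have [Lz|//] := boolP (r_ n *: theta + z *m B \in L).
  rewrite (_ : z \in C)// inE => i; rewrite -(frame_coordinates (r_ n) z oB).
  apply: mulmx_le_cube; [exact: ltW| |by rewrite inE in Lz; exact: Ls].
  by move=> j k; rewrite mxE; exact: orthonormal_frame_entry oB.
have iC : (@lebesgue_rV R m).-integrable setT (fun z => (\1_C z : R)%:E).
  apply/integrableP; split; first exact: mI.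
  under eq_integral do rewrite gee0_abs ?lee_fin//.
  rewrite integral_indic// setIT; apply: le_lt_trans (ltry ((2 * (m.+1%:R * s)) ^+ m)).
  by apply: lebesgue_rV_le_cube => //; rewrite mulr_ge0// ltW.
have [_ _] := dominated_convergence measurableT (fun n => mf (r_ n)) (mf 0) ae1 iC ae2.
rewrite /f_ /f integral_indic_slice//; under eq_fun do rewrite integral_indic_slice//.
exact.
Qed.

(** The integral over [L] of the Cauchy kernel [N / (1 + (N u)^2)] taken at
    [u = <x, y>]; the domain [L] is encoded by its indicator function. *)
Definition cauchy_average L (N : R) (x : 'rV[R]_m.+1) : \bar R :=
  (\int[lebesgue_rV]_y (\1_L y * (N * (oneDsqr (N * dotp x y))^-1))%:E)%E.

Lemma measurable_cauchy_kernel (N : R) d (T : measurableType d) (f : T -> R) :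
  measurable_fun setT f ->
  measurable_fun setT (fun t => N * (oneDsqr (N * f t))^-1).
Proof.
move=> mf; apply: measurable_funM => //.
apply: (measurableT_comp (f := fun u : R => (oneDsqr (N * u))^-1)) => //.
apply: continuous_measurable_fun => u.
apply: (@continuous_comp _ _ _ (fun u => N * u) (fun u => (oneDsqr u)^-1)).
  exact: mulrl_continuous.
exact: continuous_oneDsqrV.
Qed.

Lemma cauchy_average_ge0 L (N : R) x : 0 <= N -> (0 <= cauchy_average L N x)%E.
Proof.
move=> N0; apply: integral_ge0 => y _.
by rewrite lee_fin !mulr_ge0// invr_ge0 (le_trans ler01) ?oneDsqr_ge1.
Qed.

Lemma measurable_cauchy_average L (N : R) : measurable L -> 0 <= N ->
  measurable_fun setT (cauchy_average L N).
Proof.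
move=> mL N0; apply: (@measurable_fun_fubini_tonelli_F _ _ _ _ _
  (@lebesgue_rV R m.+1) (fun p : 'rV[R]_m.+1 * 'rV[R]_m.+1 =>
    (\1_L p.2 * (N * (oneDsqr (N * dotp p.1 p.2))^-1))%:E)) => [|p].
  apply/measurable_EFinP; apply: measurable_funM.
    by apply: (measurableT_comp _ measurable_snd); exact: measurable_indic.
  apply: measurable_cauchy_kernel; apply: measurable_dotp.
    exact: measurable_fst.
  exact: measurable_snd.
by rewrite lee_fin !mulr_ge0// invr_ge0 (le_trans ler01) ?oneDsqr_ge1.
Qed.

(** Integrate first along the hyperplanes orthogonal to [theta], then substitute
    [s = N * rho * r] in the remaining integral. *)
Lemma cauchy_average_slices L theta B (N rho : R) :
  measurable L -> enorm theta = 1 -> orthonormal_frame theta B ->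
  0 < N -> 0 < rho ->
  (rho%:E * cauchy_average L N (rho *: theta) =
   \int[mu]_s ((oneDsqr s)^-1%:E * slice_volume L theta B (s / (N * rho))))%E.
Proof.
move=> mL th1 oB N0 rho0.
have dotE r z : dotp (rho *: theta) (r *: theta + z *m B) = rho * r.
  rewrite dotpE linearD linearZ/= mulmxDr -scalemxAl -scalemxAr trmx_mul.
  rewrite -scalemxAl mulmxA; case: (oB) => _ Bth.
  rewrite (_ : theta *m B^T = 0); last by rewrite -[RHS]trmx0 -Bth trmx_mul trmxK.
  rewrite mul0mx scaler0 addr0 dotp_mulmx !mxE eqxx mulr1n.
  by rewrite -(sqr_sqrtr (dotp_ge0 theta)) -/(enorm theta) th1 expr1n mulr1.
have mk : measurable_fun setT (fun y : 'rV[R]_m.+1 =>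
    (\1_L y * (N * (oneDsqr (N * dotp (rho *: theta) y))^-1))%:E).
  apply/measurable_EFinP; apply: measurable_funM; first exact: measurable_indic.
  apply: measurable_cauchy_kernel; apply: measurable_dotp.
    exact: measurable_cst.
  exact: measurable_id.
have k0 (y : 'rV[R]_m.+1) : (0 <= (\1_L y * (N * (oneDsqr (N * dotp (rho *: theta) y))^-1))%:E)%E.
  by rewrite lee_fin mulr_ge0// mulr_ge0// ?(ltW N0)// invr_ge0 (le_trans ler01) ?oneDsqr_ge1.
rewrite /cauchy_average (ge0_integral_slices th1 oB mk k0).
pose h (s : R) : \bar R := ((oneDsqr s)^-1%:E * slice_volume L theta B (s / (N * rho)))%E.
have Nr : 0 < N * rho by exact: mulr_gt0.
have mh : measurable_fun setT h.
  apply: emeasurable_funM.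
    apply/measurable_EFinP; apply: continuous_measurable_fun.
    exact: continuous_oneDsqrV.
  apply: (measurableT_comp (measurable_slice_volume theta B mL)).
  exact: measurable_funM.
have h0 s : (0 <= h s)%E.
  by apply: mule_ge0 => //; rewrite lee_fin invr_ge0 (le_trans ler01) ?oneDsqr_ge1.
rewrite -(ge0_integral_lebesgue_scale Nr mh h0).
rewrite -ge0_integralZl//; last 3 first.
- apply: (@measurable_fun_fubini_tonelli_F _ _ _ _ _ (@lebesgue_rV R m)
    (fun p : measurableTypeR R * 'rV[R]_m => (\1_L (p.1 *: theta + p.2 *m B)
      * (N * (oneDsqr (N * dotp (rho *: theta) (p.1 *: theta + p.2 *m B)))^-1))%:E)).
    exact: (measurableT_comp mk (measurable_slice_param theta B)).
  by move=> p; exact: k0.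
- by move=> r _; apply: integral_ge0 => z _; exact: k0.
- by rewrite lee_fin ltW.
apply: eq_integral => r _; rewrite /h.
under eq_integral do rewrite dotE mulrC EFinM.
rewrite ge0_integralZl//; last 2 first.
- apply/measurable_EFinP; apply: (measurableT_comp _ (measurable_slice theta B r)).
  exact: measurable_indic.
- by rewrite lee_fin mulr_ge0// ?(ltW N0)// invr_ge0 (le_trans ler01) ?oneDsqr_ge1.
rewrite integral_indic_slice// (_ : N * rho * r / (N * rho) = r); last first.
  by rewrite mulrAC mulfV ?mul1r// gt_eqF.
by rewrite !muleA -!EFinM; congr (_%:E * _)%E; rewrite !mulrA [rho * N]mulrC.
Qed.

Let integral_oneDsqrV : (\int[mu]_s (oneDsqr s)^-1%:E = (pi : R)%:E)%E.
Proof.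
rewrite ge0_symfun_integralT//.
- rewrite (_ : [set x | _] = `[0, +oo[%classic); last first.
    by apply/seteqP; split => x /=; rewrite in_itv/= andbT.
  by rewrite integral0y_oneDsqr -EFinM; congr EFin; field.
- exact: continuous_oneDsqrV.
- by move=> s /=; rewrite /oneDsqr sqrrN.
Qed.

Lemma cvg_cauchy_average L theta B (rho : R) : star_body L ->
  enorm theta = 1 -> orthonormal_frame theta B -> 0 < rho ->
  cauchy_average L n.+1%:R (rho *: theta) @[n --> \oo] -->
    ((pi / rho)%:E * slice_volume L theta B 0)%E.
Proof.
move=> sL th1 oB rho0; have mL := star_body_measurable sL.
have [M M0 LM] := slice_volume_le sL.
pose f_ n (s : R) : \bar R := ((oneDsqr s)^-1%:E * slice_volume L theta B (s / (n.+1%:R * rho)))%E.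
pose f (s : R) : \bar R := ((oneDsqr s)^-1%:E * slice_volume L theta B 0)%E.
pose g (s : R) : \bar R := (M%:E * (oneDsqr s)^-1%:E)%E.
have mo : measurable_fun setT (fun s : R => (oneDsqr s)^-1%:E).
  by apply/measurable_EFinP; apply: continuous_measurable_fun; exact: continuous_oneDsqrV.
have o0 (s : R) : (0 <= (oneDsqr s)^-1%:E)%E.
  by rewrite lee_fin invr_ge0 (le_trans ler01) ?oneDsqr_ge1.
have sv_ge0 r : (0 <= slice_volume L theta B r)%E by exact: measure_ge0.
have mf_ n : measurable_fun setT (f_ n).
  apply: emeasurable_funM => //.
  apply: (measurableT_comp (measurable_slice_volume theta B mL)).
  exact: measurable_funM.
have mf : measurable_fun setT f by apply: emeasurable_funM => //; exact: measurable_cst.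
have ae1 : {ae mu, forall s, setT s -> f_ ^~ s @ \oo --> f s}.
  apply: aeW => s _; rewrite /f_ /f; apply: cvgeZl => //.
  apply: cvg_slice_volume => //.
  rewrite -(mulr0 (s / rho)).
  under eq_fun do rewrite invfM mulrCA mulrC.
  apply: cvgMl_tmp; exact: cvg_harmonic.
have ig : mu.-integrable setT g.
  apply/integrableP; split; first by apply: emeasurable_funM => //; exact: measurable_cst.
  under eq_integral do rewrite gee0_abs ?mule_ge0 ?lee_fin ?(ltW M0)//.
  rewrite ge0_integralZl// ?lee_fin ?(ltW M0)//.
  by rewrite integral_oneDsqrV -EFinM ltry.
have ae2 : {ae mu, forall s n, setT s -> (`|f_ n s| <= g s)%E}.
  apply: aeW => s n _; rewrite gee0_abs; last exact: mule_ge0.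
  by rewrite /f_ /g muleC lee_wpmul2r//; exact: LM.
have [_ _] := @dominated_convergence _ (measurableTypeR R) R mu setT measurableT
  f_ f g mf_ mf ae1 ig ae2.
rewrite /f ge0_integralZr// integral_oneDsqrV => cv.
have -> : (pi / rho)%:E = (rho^-1%:E * pi%:E)%E :> \bar R by rewrite -EFinM mulrC.
rewrite -muleA.
have -> : (fun n => cauchy_average L n.+1%:R (rho *: theta)) =
    (fun n => rho^-1%:E * \int[mu]_s f_ n s)%E.
  apply/funext => n; rewrite /f_ -(cauchy_average_slices mL th1 oB)//.
  by rewrite muleA -EFinM mulVf ?gt_eqF// mul1e.
exact: cvgeZl.
Qed.

Lemma cauchy_average_le L : star_body L -> exists2 M : R, 0 < M &
  forall theta B (N rho : R), enorm theta = 1 -> orthonormal_frame theta B ->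
  0 < N -> 0 < rho ->
  (cauchy_average L N (rho *: theta) <= (M * pi / rho)%:E)%E.
Proof.
move=> sL; have mL := star_body_measurable sL.
have [M M0 LM] := slice_volume_le sL; exists M => //.
move=> theta B N rho th1 oB N0 rho0.
rewrite mulrC EFinM -lee_pdivrMl ?invr_gt0// invrK.
rewrite (cauchy_average_slices mL th1 oB)//.
have mo : measurable_fun setT (fun s : R => (oneDsqr s)^-1%:E).
  by apply/measurable_EFinP; apply: continuous_measurable_fun; exact: continuous_oneDsqrV.
have o0 (s : R) : (0 <= (oneDsqr s)^-1%:E)%E.
  by rewrite lee_fin invr_ge0 (le_trans ler01) ?oneDsqr_ge1.
rewrite EFinM -integral_oneDsqrV -ge0_integralZl// ?lee_fin ?(ltW M0)//.
apply: ge0_le_integral => //.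
- by move=> s _; apply: mule_ge0 => //; exact: measure_ge0.
- apply: emeasurable_funM => //.
  apply: (measurableT_comp (measurable_slice_volume theta B mL)).
  exact: measurable_funM.
- by apply: emeasurable_funM => //; exact: measurable_cst.
- by move=> s _; rewrite muleC lee_wpmul2r//; exact: LM.
Qed.


End slice_volume.

(** * The radial function of an intersection body as a limit *)

Section intersection_body.
Context {R : realType} {m : nat}.
Implicit Types (K L : set 'rV[R]_m.+1).

Lemma hyperplane_volume_slice L (theta : 'rV[R]_m.+1) : enorm theta = 1 ->
  hyperplane_volume theta (L `&` hyperplane theta) =
  slice_volume L theta (get (orthonormal_frame theta)) 0.
Proof.
move=> th1; have [B oB] := orthonormal_frame_nonempty th1.
have [_ Bth] : orthonormal_frame theta (get (orthonormal_frame theta)) by exact: getI oB.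
congr lebesgue_rV; apply/seteqP; split => z /=; rewrite scale0r add0r.
  by case.
move=> Lz; split => //; rewrite /hyperplane/= dotpE -mulmxA Bth mulmx0.
by rewrite mxE.
Qed.

Lemma inv_minkowski_slice K L (x : 'rV[R]_m.+1) : star_body L ->
  is_intersection_body K L -> x != 0 ->
  exists theta B (rho v : R), [/\ x = rho *: theta, enorm theta = 1,
    orthonormal_frame theta B, 0 < rho & 0 < v] /\
    slice_volume L theta B 0 = v%:E /\
    (minkowski_functional K x)^-1%E = (v / rho)%:E.
Proof.
move=> sL KL x0.
have rho0 : 0 < enorm x.
  rewrite sqrtr_gt0 lt_neqAle dotp_ge0 andbT eq_sym; apply: contra x0.
  rewrite psumr_eq0; last by move=> i _; rewrite -expr2 sqr_ge0.
  move=> /allP xi; apply/eqP/rowP => i; rewrite mxE.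
  have := xi i; rewrite mem_index_enum => /(_ isT).
  by rewrite mulf_eq0 orbb => /eqP.
pose theta := (enorm x)^-1 *: x.
have th1 : enorm theta = 1.
  rewrite /enorm /theta dotpE linearZ/= -scalemxAl -scalemxAr scalerA dotp_mulmx !mxE.
  rewrite eqxx mulr1n -invfM -expr2 sqr_sqrtr ?dotp_ge0//.
  by rewrite mulVf ?sqrtr1// gt_eqF// -sqrtr_gt0.
have [B0 oB0] := orthonormal_frame_nonempty th1.
pose B := get (orthonormal_frame theta).
have oB : orthonormal_frame theta B by exact: getI oB0.
have [M M0 LM] := slice_volume_le sL; have [c c0 Lc] := slice_volume_ge sL.
have vfin : slice_volume L theta B 0 \is a fin_num.
  by rewrite ge0_fin_numE ?measure_ge0// (le_lt_trans (LM _ _ _ oB)) ?ltry.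
have xE : x = enorm x *: theta by rewrite scalerA mulfV ?scale1r ?gt_eqF.
exists theta, B, (enorm x), (fine (slice_volume L theta B 0)).
have v0 : 0 < fine (slice_volume L theta B 0).
  by rewrite -lte_fin fineK// (lt_le_trans _ (Lc _ _ oB)).
split => //; split; first by rewrite fineK.
rewrite [in LHS]xE minkowski_functionalZ// KL// hyperplane_volume_slice// -/B.
rewrite -[in LHS](fineK vfin) inver (gt_eqF v0) -EFinM inver.
by rewrite mulf_eq0 invr_eq0 !gt_eqF//= invfM invrK mulrC.
Qed.

(** At the origin both sides of the limit are infinite, because [L] has positive
    measure. *)
Lemma cauchy_average_intersection_body K L : star_body K -> star_body L ->
  is_intersection_body K L ->
  exists2 C : R, 0 < C & forall x,
    cauchy_average L n.+1%:R x @[n --> \oo] -->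
      (pi%:E * (minkowski_functional K x)^-1)%E /\
    forall n, (cauchy_average L n.+1%:R x <=
               C%:E * (minkowski_functional K x)^-1)%E.
Proof.
move=> sK sL KL.
have [M M0 LM] := cauchy_average_le sL; have [c c0 Lc] := slice_volume_ge sL.
exists (M * pi / c); first by rewrite divr_gt0// mulr_gt0// pi_gt0.
move=> x; have [->|x0] := eqVneq x 0.
  rewrite minkowski_functional0// inve0 !gt0_muley ?lte_fin ?pi_gt0//; last first.
    by rewrite divr_gt0// mulr_gt0// pi_gt0.
  split; last by move=> n; exact: leey.
  have [s s0 Ls] := star_body_cube sL.
  pose v := (2 * s) ^+ m.+1.
  have v0 : 0 < v by rewrite exprn_gt0// mulr_gt0.
  have mL := star_body_measurable sL.
  have aE n : (n.+1%:R%:E * v%:E <= cauchy_average L n.+1%:R 0)%E.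
    rewrite /cauchy_average.
    under eq_integral do rewrite dotpE mul0mx mxE mulr0 /oneDsqr expr0n addr0 invr1 mulr1 mulrC EFinM.
    rewrite ge0_integralZl//; last first.
      by apply/measurable_EFinP; exact: measurable_indic.
    rewrite integral_indic// setIT lee_pmul2l//.
    by apply: lebesgue_rV_ge_cube => //; exact: ltW.
  apply/cvgeyPge => A; near=> n; apply: le_trans (aE n).
  rewrite -EFinM lee_fin -ler_pdivrMr// (@le_trans _ _ n%:R) ?ler_nat//.
  by near: n; exact: nbhs_infty_ger.
have [th [B [rho [v [[xE th1 oB rho0 v0] [vE ->]]]]]] := inv_minkowski_slice sL KL x0.
split.
  have := cvg_cauchy_average sL th1 oB rho0.
  by rewrite vE -!EFinM xE mulrAC -mulrA.
move=> n; rewrite xE; apply: le_trans (LM _ B _ _ th1 oB _ rho0) _ => //.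
rewrite -EFinM lee_fin -!mulrA ler_pM2l// ler_pM2l ?pi_gt0//.
rewrite mulrA ler_pMl ?invr_gt0//.
by rewrite -(mulVf (lt0r_neq0 c0)) ler_pM2l ?invr_gt0// -lee_fin -vE; exact: Lc.
Unshelve. all: by end_near. Qed.

End intersection_body.

(** * Integration against a density *)

Section density.
Context d1 d2 (T1 : measurableType d1) (T2 : measurableType d2) (R : realType).
Variables (mu : {measure set T1 -> \bar R}) (nu : {measure set T2 -> \bar R}).
Variables (X : T1 -> T2) (G : T1 -> R).
Hypotheses (mX : measurable_fun setT X) (mG : measurable_fun setT G).
Hypothesis G0 : forall x, 0 <= G x.
Hypothesis nuE : forall A, measurable A ->
  nu A = (\int[mu]_(x in X @^-1` A) (G x)%:E)%E.

Import HBNNSimple.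

Let mGE : measurable_fun setT (EFin \o G).
Proof. exact/measurable_EFinP. Qed.

Let nnsfun_density (g : {nnsfun T2 >-> R}) :
  (\int[nu]_y (g y)%:E = \int[mu]_x ((g (X x))%:E * (G x)%:E))%E.
Proof.
have mgX r : measurable (X @^-1` (g @^-1` [set r])).
  by rewrite -[X in measurable X]setTI; exact: mX.
have mi r : measurable_fun setT (fun x => (\1_(g @^-1` [set r]) (X x) : R)%:E).
  apply/measurable_EFinP; apply: (measurableT_comp _ mX).
  exact: measurable_indic.
transitivity (\sum_(r \in range g) (r%:E * nu (g @^-1` [set r])))%E.
  under eq_integral do rewrite fimfunE -fsumEFin//.
  rewrite ge0_integral_fsum//; last 2 first.
  - by move=> y; exact/measurable_EFinP/measurable_funM.
  - by move=> y x _; rewrite nnfun_muleindic_ge0.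
  apply: eq_fsbigr => r _; rewrite integralZl_indic_nnsfun//.
  by rewrite integral_indic// setIT.
under [RHS]eq_integral => x _.
  rewrite fimfunE -fsumEFin// ge0_mule_fsuml; last first.
    by move=> r; rewrite nnfun_muleindic_ge0.
  over.
rewrite ge0_integral_fsum//; last 2 first.
- move=> r; apply: emeasurable_funM => //; under eq_fun do rewrite EFinM.
  by apply: emeasurable_funM => //; exact: measurable_cst.
- by move=> r x _; apply: mule_ge0; rewrite ?lee_fin ?G0// -lee_fin EFinM nnfun_muleindic_ge0.
apply: eq_fsbigr => r; rewrite inE => -[y _ yr].
have r0 : (0 <= r)%R by rewrite -yr.
under eq_integral do rewrite EFinM -muleA.
rewrite ge0_integralZl//; last 2 first.
- exact: emeasurable_funM.
- by move=> x _; rewrite mule_ge0// lee_fin.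
rewrite nuE// integral_mkcond; congr (_ * _)%E; apply: eq_integral => x _.
rewrite patchE indicE; case: ifPn => xg.
  by rewrite mem_set ?mul1e//; rewrite inE in xg.
by rewrite memNset ?mul0e//; rewrite notin_setE in xg.
Qed.

(** [nu] is the image under [X] of the measure of density [G] with respect to
    [mu]. *)
Lemma ge0_integral_density (h : T2 -> \bar R) :
  measurable_fun setT h -> (forall y, (0 <= h y)%E) ->
  (\int[nu]_y h y = \int[mu]_x (h (X x) * (G x)%:E))%E.
Proof.
move=> mh h0; pose h_ := nnsfun_approx measurableT mh.
have cvh y : (EFin \o h_^~ y) @ \oo --> h y.
  exact: (cvg_nnsfun_approx measurableT mh (fun x _ => h0 x)).
have -> : (\int[nu]_y h y = limn (fun n => \int[nu]_y (h_ n y)%:E))%E.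
  rewrite -monotone_convergence//.
  - by apply: eq_integral => y _; apply/esym/cvg_lim => //; exact: cvh.
  - by move=> n; exact/measurable_EFinP/measurable_funP.
  - by move=> n y _; rewrite lee_fin.
  - by move=> y _ m n mn; rewrite lee_fin; exact/lefP/nd_nnsfun_approx.
under eq_fun do rewrite nnsfun_density.
rewrite -monotone_convergence//.
- apply: eq_integral => x _; apply/cvg_lim => //.
  by apply: cvgeZr => //; exact: cvh.
- move=> n; apply: emeasurable_funM => //; apply/measurable_EFinP.
  by apply: (measurableT_comp _ mX); exact: measurable_funP.
- by move=> n x _; rewrite mule_ge0// lee_fin.
- move=> x _ m n mn; rewrite lee_wpmul2r// ?lee_fin//.
  exact/lefP/nd_nnsfun_approx.
Qed.

End density.

(** * Expectations of bounded functions and independence *)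

Section independence.
Context d (T : measurableType d) (R : realType) (P : probability T R).
Implicit Types f g F : T -> R.

(** Measurable functions bounded by 1, the class to which cosines, sines and
    indicators belong and which products preserve. *)
Definition bounded_mfun d' (T' : measurableType d') (f : T' -> R) : Prop :=
  measurable_fun setT f /\ forall w, `|f w| <= 1.

Lemma bounded_mfun_integrable f : bounded_mfun f ->
  P.-integrable setT (EFin \o f).
Proof.
move=> [mf f1]; apply/integrableP; split; first exact/measurable_EFinP.
apply: le_lt_trans (_ : \int[P]_w (cst 1%E w) < +oo)%E; last first.
  rewrite integral_cst// mul1e.
  by apply: (le_lt_trans (probability_le1 P measurableT)); rewrite ltry.
apply: ge0_le_integral => //.
  by apply/measurable_EFinP; apply: measurableT_comp => //; exact/measurable_EFinP.
by move=> w _; rewrite lee_fin f1.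
Qed.

Lemma bounded_mfunM d' (T' : measurableType d') (f g : T' -> R) :
  bounded_mfun f -> bounded_mfun g -> bounded_mfun (fun w => f w * g w).
Proof.
move=> [mf f1] [mg g1]; split; first exact: measurable_funM.
by move=> w; rewrite normrM mulr_ile1.
Qed.

Lemma bounded_mfun_comp d1 d2 (T1 : measurableType d1) (T2 : measurableType d2)
    (X : T1 -> T2) (h : T2 -> R) : measurable_fun setT X -> bounded_mfun h ->
  bounded_mfun (fun w => h (X w)).
Proof. by move=> mX [mh h1]; split; first exact: (measurableT_comp mh mX). Qed.

Lemma bounded_mfun_indic d' (T' : measurableType d') (A : set T') :
  measurable A -> bounded_mfun (\1_A : T' -> R).
Proof.
move=> mA; split; first exact: measurable_indic.
by move=> w; rewrite indicE; case: (_ \in _); rewrite ?normr1 ?normr0.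
Qed.

Lemma bounded_mfun_cos d' (T' : measurableType d') (u : T' -> R) :
  measurable_fun setT u -> bounded_mfun (fun w => cos (u w)).
Proof.
move=> mu; split; last by move=> w; rewrite ler_norml cos_geN1 cos_le1.
apply: (measurableT_comp _ mu); apply: continuous_measurable_fun.
exact: continuous_cos.
Qed.

Lemma bounded_mfun_sin d' (T' : measurableType d') (u : T' -> R) :
  measurable_fun setT u -> bounded_mfun (fun w => sin (u w)).
Proof.
move=> mu; split; last by move=> w; rewrite ler_norml sin_geN1 sin_le1.
apply: (measurableT_comp _ mu); apply: continuous_measurable_fun.
exact: continuous_sin.
Qed.

Lemma Rintegral_indic (A : set T) : measurable A ->
  \int[P]_w (\1_A w) = fine (P A).
Proof. by move=> mA; rewrite /Rintegral integral_indic// setIT. Qed.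

Lemma EFin_Rintegral f : bounded_mfun f ->
  (\int[P]_w (f w)%:E = (\int[P]_w f w)%:E)%E.
Proof.
move=> bf; rewrite /Rintegral fineK//; apply: integrable_fin_num => //.
exact: bounded_mfun_integrable.
Qed.

(** The hypothesis says that the conditional mean of [F] given [X] is the constant
    [c]. The proof compares two measures, which have to be nonnegative: this is
    why 1 is added to [F] and to [h]. *)
Lemma Rintegral_decouple d' (T' : measurableType d') (X : T -> T') F (h : T' -> R) (c : R) :
  measurable_fun setT X -> bounded_mfun F -> bounded_mfun h ->
  (forall A, measurable A -> \int[P]_w (F w * \1_A (X w)) = c * \int[P]_w (\1_A (X w))) ->
  \int[P]_w (F w * h (X w)) = c * \int[P]_w (h (X w)).
Proof.
move=> mX bF bh FA.
have b1 : bounded_mfun (cst 1 : T -> R).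
  by split => // w; rewrite normr1.
have E1 : \int[P]_w (1 : R) = 1.
  by rewrite Rintegral_cst// mul1r; exact: (congr1 fine (@probability_setT _ _ _ P)).
have cE : c = \int[P]_w F w.
  have := FA setT measurableT; rewrite indicT.
  under eq_Rintegral do rewrite mulr1.
  by rewrite E1 mulr1.
have c1 : 0 <= c + 1.
  rewrite cE -E1 -RintegralD//; [|exact: bounded_mfun_integrable..].
  apply: Rintegral_ge0 => w _; rewrite -lerBlDr sub0r.
  by have := bF.2 w; rewrite ler_norml => /andP[].
have bX (g : T' -> R) : bounded_mfun g -> bounded_mfun (fun w => g (X w)).
  by move=> bg; exact: bounded_mfun_comp.
have mXA A : measurable A -> measurable (X @^-1` A).
  by move=> mA; have := mX measurableT A mA; rewrite setTI.
pose mu0 : {measure set T' -> \bar R} :=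
  measure_function_pushforward__canonical__measure_function_Measure P mX.
pose nu : {measure set T' -> \bar R} := mscale (NngNum c1) mu0.
have nuE A : measurable A -> nu A = (\int[P]_(w in X @^-1` A) (F w + 1)%:E)%E.
  move=> mA; rewrite /nu/= /mscale/= /mu0/= /pushforward.
  rewrite integral_mkcond.
  transitivity (\int[P]_w (F w * \1_A (X w))%:E + \int[P]_w (\1_A (X w) : R)%:E)%E.
    have bA := bounded_mfun_indic mA.
    rewrite (EFin_Rintegral (bounded_mfunM bF (bX _ bA))) (EFin_Rintegral (bX _ bA)).
    have IA : \int[P]_w (\1_A (X w)) = fine (P (X @^-1` A)).
      by rewrite -(Rintegral_indic (mXA _ mA)); apply: eq_Rintegral => w _; rewrite !indicE.
    rewrite FA// IA -[P _]fineK ?fin_num_measure//; last exact: mXA.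
    by rewrite -EFinD -EFinM; congr EFin; rewrite mulrDl mul1r.
  have bA := bounded_mfun_indic mA.
  rewrite -integralD//; last 2 first.
  - exact: bounded_mfun_integrable (bounded_mfunM bF (bX _ bA)).
  - exact: bounded_mfun_integrable (bX _ bA).
  apply: eq_integral => w _; rewrite patchE indicE -EFinD.
  case: ifPn => wA; first by rewrite mem_set ?mulr1//; rewrite inE in wA.
  by rewrite memNset ?mulr0 ?addr0//; rewrite notin_setE in wA.
have mF1 : measurable_fun setT (fun w => F w + 1).
  by apply: measurable_funD => //; exact: bF.1.
have F10 w : 0 <= F w + 1.
  by rewrite -lerBlDr sub0r; have := bF.2 w; rewrite ler_norml => /andP[].
have mh1 : measurable_fun setT (fun y => (h y + 1)%:E).
  by apply/measurable_EFinP; apply: measurable_funD => //; exact: bh.1.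
have h10 y : (0 <= (h y + 1)%:E)%E.
  by rewrite lee_fin -lerBlDr sub0r; have := bh.2 y; rewrite ler_norml => /andP[].
have := ge0_integral_density mX mF1 F10 nuE mh1 h10.
rewrite /nu ge0_integral_mscale// /mu0 ge0_integral_pushforward//=.
have iF := bounded_mfun_integrable bF; have ih := bounded_mfun_integrable (bX _ bh).
have i1 := bounded_mfun_integrable b1.
have iFh := bounded_mfun_integrable (bounded_mfunM bF (bX _ bh)).
rewrite preimage_setT.
have iD (f g : T -> R) : P.-integrable setT (EFin \o f) ->
    P.-integrable setT (EFin \o g) ->
    P.-integrable setT (EFin \o (fun w => f w + g w)).
  by move=> If Ig; exact: (integrableD measurableT If Ig).
have ih1 := iD _ _ ih i1; have iF1 := iD _ _ iF i1; have ihF := iD _ _ ih iF1.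
have <- : (\int[P]_w (h (X w) + 1)%:E)%E = (\int[P]_x (h (X x) + 1)%:E)%E by [].
rewrite -[X in (_ * X)%E]fineK; last exact: (integrable_fin_num measurableT ih1).
rewrite -EFinM => /(congr1 fine) /=.
rewrite -/(Rintegral P setT (fun w => h (X w) + 1)) RintegralD// E1.
have -> : fine (\int[P]_x ((h (X x) + 1)%:E * (F x + 1)%:E))%E =
    \int[P]_w (F w * h (X w) + (h (X w) + (F w + 1))).
  by congr fine; apply: eq_integral => w _; rewrite -EFinM; congr EFin; ring.
rewrite (RintegralD measurableT iFh ihF) (RintegralD measurableT ih iF1).
rewrite (RintegralD measurableT iF i1) E1 -cE => hh.
by lra.
Qed.

End independence.

Section cos_of_independent_sum.
Context d d' (T : measurableType d) (T' : measurableType d') (R : realType).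
Context (P : probability T R) (I : finType).
Variables (X : I -> T -> T') (u : I -> T' -> R) (c : I -> R).
Hypothesis mX : forall i, measurable_fun setT (X i).
Hypothesis indX : mutually_independent P X.
Hypothesis mu : forall i, measurable_fun setT (u i).
Hypothesis cosE : forall i, \int[P]_w cos (u i (X i w)) = c i.
Hypothesis sinE : forall i, \int[P]_w sin (u i (X i w)) = 0.

(* The events that constrain only the [X i] with [i \notin s]. *)
Let cyl (s : seq I) (A : I -> set T') : set T :=
  \bigcap_(i in [set i | i \notin s]) (X i @^-1` A i).

Let mXA i B : measurable B -> measurable (X i @^-1` B).
Proof. by move=> mB; have := mX i measurableT mB; rewrite setTI. Qed.

Let mcyl s A : (forall i, measurable (A i)) -> measurable (cyl s A).
Proof. by move=> mA; apply: fin_bigcap_measurable => [|i _]; [exact: finite_finset|exact: mXA]. Qed.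

Let PcylE s A : (forall i, measurable (A i)) ->
  P (cyl s A) = (\prod_(i | i \notin s) P (X i @^-1` A i))%E.
Proof.
move=> mA; have := indX [set i | i \notin s]%SET mA.
rewrite (eq_bigl (fun i => i \notin s)); last by move=> i; rewrite inE.
move=> <-; congr (P _); apply/seteqP; split => w cw i.
  by move=> /= si; apply: cw; rewrite /= inE in si.
by move=> /= si; apply: cw; rewrite /= inE.
Qed.

Let Pcyl_cons j s A : j \notin s -> (forall i, measurable (A i)) ->
  P (cyl s A) = (P (cyl (j :: s) A) * P (X j @^-1` A j))%E.
Proof.
move=> js mA; rewrite !PcylE// (bigD1 j)//= muleC; congr (_ * _)%E.
by apply: eq_bigl => i; rewrite inE negb_or andbC.
Qed.

(* The variables enter the sum one at a time; those which have not entered yet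
   are kept as an event, as mutual independence speaks of events only. *)
Let trig_cyl s : uniq s -> forall A, (forall i, measurable (A i)) ->
  \int[P]_w (cos (\sum_(i <- s) u i (X i w)) * \1_(cyl s A) w) =
    (\prod_(i <- s) c i) * fine (P (cyl s A)) /\
  \int[P]_w (sin (\sum_(i <- s) u i (X i w)) * \1_(cyl s A) w) = 0.
Proof.
elim: s => [_ A mA|j s IH /= /andP[js us] A mA].
  have mC := mcyl [::] mA.
  rewrite big_nil mul1r -Rintegral_indic//; split.
    by apply: eq_Rintegral => w _; rewrite big_nil cos0 mul1r.
  under eq_Rintegral do rewrite big_nil sin0 mul0r.
  by rewrite Rintegral_cst// mul0r.
have mS : measurable_fun setT (fun w => \sum_(i <- s) u i (X i w)).
  apply: (@measurable_sum _ _ _ _ _ s (fun i w => u i (X i w))) => i.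
  exact: (measurableT_comp (mu i) (mX i)).
pose A' B i := if i == j then B else A i.
have mA' B : measurable B -> forall i, measurable (A' B i).
  by move=> mB i; rewrite /A'; case: ifP.
have cylA' B : cyl (j :: s) (A' B) = cyl (j :: s) A.
  apply/seteqP; split => w cw i /[dup] /= si; rewrite inE negb_or => /andP[ij _].
    by have := cw i si; rewrite /A' /= (negPf ij).
  by rewrite /A' /= (negPf ij); exact: cw.
have indic_cyl B w : \1_(cyl (j :: s) A) w * \1_B (X j w) = \1_(cyl s (A' B)) w :> R.
  have -> : cyl s (A' B) = cyl (j :: s) A `&` (X j @^-1` B).
    apply/seteqP; split => [v cv|v [cv Bv] i /= si]; last first.
      rewrite /A'; case: eqP => [->//|/eqP ij]; apply: cv.
      by rewrite /= inE negb_or ij.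
    split; last by have := cv j js; rewrite /A' eqxx.
    rewrite -(cylA' B) => i /=; rewrite inE negb_or => /andP[_ si].
    exact: cv.
  by rewrite indicI.
have mC := mcyl (j :: s) mA.
have bC : bounded_mfun (\1_(cyl (j :: s) A) : T -> R) by exact: bounded_mfun_indic.
have bcos := bounded_mfunM (bounded_mfun_cos mS) bC.
have bsin := bounded_mfunM (bounded_mfun_sin mS) bC.
have PcylB B : measurable B ->
    fine (P (cyl s (A' B))) = fine (P (cyl (j :: s) A)) * \int[P]_w (\1_B (X j w)).
  move=> mB; rewrite (Pcyl_cons js (mA' _ mB)) cylA' /A' eqxx.
  rewrite fineM ?fin_num_measure//; last exact: mXA.
  congr (_ * _); rewrite -(Rintegral_indic P (mXA j mB)).
  by apply: eq_Rintegral => w _; rewrite !indicE.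
set p := fine _.
have Dcos h : bounded_mfun h ->
    \int[P]_w (cos (\sum_(i <- s) u i (X i w)) * \1_(cyl (j :: s) A) w * h (X j w)) =
    (\prod_(i <- s) c i) * p * \int[P]_w h (X j w).
  move=> bh; apply: Rintegral_decouple => // B mB.
  rewrite -mulrA -PcylB// -(IH us _ (mA' _ mB)).1.
  by apply: eq_Rintegral => w _; rewrite -mulrA indic_cyl.
have Dsin h : bounded_mfun h ->
    \int[P]_w (sin (\sum_(i <- s) u i (X i w)) * \1_(cyl (j :: s) A) w * h (X j w)) = 0.
  move=> bh; rewrite -[RHS](mul0r (\int[P]_w h (X j w))).
  apply: Rintegral_decouple => // B mB.
  rewrite mul0r -[RHS](IH us _ (mA' _ mB)).2.
  by apply: eq_Rintegral => w _; rewrite -mulrA indic_cyl.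
have bcosj := bounded_mfun_cos (mu j); have bsinj := bounded_mfun_sin (mu j).
have bX h : bounded_mfun h -> bounded_mfun (fun w => h (X j w)).
  exact: bounded_mfun_comp.
have int2 f h : bounded_mfun f -> bounded_mfun h ->
  P.-integrable setT (EFin \o (fun w => f w * h (X j w))).
  by move=> bf bh; apply: bounded_mfun_integrable; apply: bounded_mfunM => //; exact: bX.
split.
  rewrite big_cons.
  transitivity (\int[P]_w (cos (\sum_(i <- s) u i (X i w)) * \1_(cyl (j :: s) A) w * cos (u j (X j w))
    - sin (\sum_(i <- s) u i (X i w)) * \1_(cyl (j :: s) A) w * sin (u j (X j w)))).
    apply: eq_Rintegral => w _; rewrite big_cons addrC cosD.
    by rewrite mulrBl; congr (_ - _); rewrite mulrAC.
  rewrite (RintegralB measurableT (int2 _ _ bcos bcosj) (int2 _ _ bsin bsinj)).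
  by rewrite (Dcos _ bcosj) (Dsin _ bsinj) cosE subr0; ring.
transitivity (\int[P]_w (sin (\sum_(i <- s) u i (X i w)) * \1_(cyl (j :: s) A) w * cos (u j (X j w))
    + cos (\sum_(i <- s) u i (X i w)) * \1_(cyl (j :: s) A) w * sin (u j (X j w)))).
  apply: eq_Rintegral => w _; rewrite big_cons addrC sinD.
  by rewrite mulrDl; congr (_ + _); rewrite mulrAC.
rewrite (RintegralD measurableT (int2 _ _ bsin bcosj) (int2 _ _ bcos bsinj)).
by rewrite (Dcos _ bsinj) (Dsin _ bcosj) sinE mulr0 addr0.
Qed.

Lemma Rintegral_cos_independent_sum :
  \int[P]_w cos (\sum_i u i (X i w)) = \prod_i c i.
Proof.
have [+ _] := trig_cyl (index_enum_uniq I) (fun=> @measurableT _ T').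
rewrite (_ : cyl _ _ = setT); last first.
  by apply/seteqP; split => // w _ i; rewrite /= mem_index_enum.
rewrite (_ : fine (P setT) = 1); last exact: (congr1 fine (@probability_setT _ _ _ P)).
rewrite mulr1 => <-.
by apply: eq_Rintegral => w _; rewrite indicT mulr1.
Qed.

End cos_of_independent_sum.

(** * The Fourier transform of a density and the Cauchy kernel *)

Section fourier_law.
Context d (T : measurableType d) (R : realType) (P : probability T R) (n : nat).
Variables (X : T -> 'rV[R]_n) (phi : 'rV[R]_n -> R).
Hypotheses (mX : measurable_fun setT X) (mphi : measurable_fun setT phi).
Hypothesis phi0 : forall x, 0 <= phi x.
Hypothesis lawX : forall A : set 'rV[R]_n, measurable A ->
  P (X @^-1` A) = (\int[@lebesgue_rV R n]_(x in A) (phi x)%:E)%E.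

Let mass_phi : (\int[@lebesgue_rV R n]_x (phi x)%:E = 1)%E.
Proof. by rewrite -lawX// preimage_setT; exact: (@probability_setT _ _ _ P). Qed.

Let integrable_phi : (@lebesgue_rV R n).-integrable setT (EFin \o phi).
Proof.
apply/integrableP; split; first exact/measurable_EFinP.
under eq_integral do rewrite /= ger0_norm//.
by rewrite mass_phi ltry.
Qed.

Lemma Rintegral_law_density (h : 'rV[R]_n -> R) : bounded_mfun h ->
  \int[P]_w h (X w) = \int[@lebesgue_rV R n]_y (h y * phi y).
Proof.
move=> bh.
pose nu : {measure set 'rV[R]_n -> \bar R} :=
  measure_function_pushforward__canonical__measure_function_Measure P mX.
have mh1 : measurable_fun setT (fun y => (h y + 1)%:E).
  by apply/measurable_EFinP; apply: measurable_funD => //; exact: bh.1.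
have h10 y : (0 <= (h y + 1)%:E)%E.
  by rewrite lee_fin -lerBlDr sub0r; have := bh.2 y; rewrite ler_norml => /andP[].
have := @ge0_integral_density _ _ _ _ R (@lebesgue_rV R n) nu id phi
  (@measurable_id _ _ _) mphi phi0 lawX _ mh1 h10.
rewrite ge0_integral_pushforward//= preimage_setT.
have bhX : bounded_mfun (fun w => h (X w)) by exact: bounded_mfun_comp.
have b1 : bounded_mfun (cst 1 : T -> R).
  by split => // w; rewrite normr1.
have ihX := bounded_mfun_integrable P bhX; have i1 := bounded_mfun_integrable P b1.
have ihphi : (@lebesgue_rV R n).-integrable setT (EFin \o (fun y => h y * phi y)).
  apply: (le_integrable measurableT _ _ integrable_phi).
    by apply/measurable_EFinP; apply: measurable_funM => //; exact: bh.1.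
  move=> y _ /=; rewrite lee_fin normrM ler_piMl//; exact: bh.2.
have -> : (\int[@lebesgue_rV R n]_x ((h x + 1)%:E * (phi x)%:E) =
    \int[@lebesgue_rV R n]_x (h x * phi x + phi x)%:E)%E.
  by apply: eq_integral => y _; rewrite -EFinM mulrDl mul1r.
move=> /(congr1 fine) hh.
have {hh} : \int[P]_w (h (X w) + 1) =
    \int[@lebesgue_rV R n]_y (h y * phi y + phi y) by exact: hh.
rewrite (RintegralD measurableT ihX i1) (RintegralD measurableT ihphi integrable_phi).
have -> : \int[P]_w (1 : R) = 1.
  by rewrite Rintegral_cst// mul1r; exact: (congr1 fine (@probability_setT _ _ _ P)).
have -> : \int[@lebesgue_rV R n]_y phi y = 1 by rewrite /Rintegral mass_phi.
by move/addIr.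
Qed.

Let phihat := fourier (fun y => (phi y)%:C%C).

Lemma Re_fourier_law x :
  complex.Re (phihat x) = \int[P]_w cos (2 * pi * dotp x (X w)).
Proof.
have mx : measurable_fun setT (fun y : 'rV[R]_n => 2 * pi * dotp x y).
  apply: measurable_funM => //; apply: measurable_dotp => //.
rewrite (Rintegral_law_density (bounded_mfun_cos mx)).
by apply: eq_Rintegral => y _; rewrite /= cosN mul0r subr0 mulrC.
Qed.

Lemma Im_fourier_law x :
  complex.Im (phihat x) = - \int[P]_w sin (2 * pi * dotp x (X w)).
Proof.
have mx : measurable_fun setT (fun y : 'rV[R]_n => - (2 * pi * dotp x y)).
  apply: measurable_funN; apply: measurable_funM => //; apply: measurable_dotp => //.
transitivity (\int[P]_w sin (- (2 * pi * dotp x (X w)))).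
  rewrite (Rintegral_law_density (bounded_mfun_sin mx)).
  by apply: eq_Rintegral => y _; rewrite /= mul0r addr0 mulrC.
have mx' : measurable_fun setT (fun w => 2 * pi * dotp x (X w)).
  by apply: measurable_funM => //; exact: measurable_dotp.
rewrite -mulN1r -RintegralZl//; last first.
  exact: bounded_mfun_integrable (bounded_mfun_sin mx').
by apply: eq_Rintegral => w _; rewrite sinN mulN1r.
Qed.

End fourier_law.

Section exp_cos.
Context {R : realType}.
Local Notation mu := (@lebesgue_measure R).

Lemma integral_expR_cos (u : R) :
  (\int[mu]_(s in `[0%R, +oo[) (expR (- s) * (1 + cos (s * u)))%:E =
   (1 + (oneDsqr u)^-1)%:E)%E.
Proof.
(* an antiderivative which vanishes at infinity *)
pose F (s : R) := expR (- s) * ((u * sin (s * u) - cos (s * u)) / oneDsqr u - 1).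
have o1 : oneDsqr u != 0 by rewrite gt_eqF// (lt_le_trans ltr01) ?oneDsqr_ge1.
have dsu (s : R) : is_derive s 1 (fun t => t * u) u.
  apply: (is_derive_eq (is_deriveM (is_derive_id s (1 : R)) (is_derive_cst u s (1 : R)))).
  by rewrite scaler0 add0r /cst /GRing.scale/= mulr1.
have dsin (s : R) : is_derive s 1 (fun t => sin (t * u)) (cos (s * u) * u).
  exact: (@is_derive1_comp _ sin (fun t => t * u) _ _ _ (is_derive_sin _) (dsu s)).
have dcos (s : R) : is_derive s 1 (fun t => cos (t * u)) (- sin (s * u) * u).
  exact: (@is_derive1_comp _ cos (fun t => t * u) _ _ _ (is_derive_cos _) (dsu s)).
have dexp (s : R) : is_derive s 1 (fun t : R => expR (- t)) (expR (- s) * - 1).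
  exact: (@is_derive1_comp _ expR -%R _ _ _ (is_derive_expR _) (is_deriveN (is_derive_id s (1 : R)))).
have dF (s : R) : is_derive s 1 F (expR (- s) * (1 + cos (s * u))).
  apply: (is_derive_eq (is_deriveM (dexp s) (is_deriveB (is_deriveM (is_deriveB
    (is_deriveZ u (dsin s)) (dcos s)) (is_derive_cst (oneDsqr u)^-1 s (1 : R)))
    (is_derive_cst (1 : R) s (1 : R))))).
  change (expR (- s) * ((u * sin (s * u) - cos (s * u)) * 0 + (oneDsqr u)^-1 *
      (u * (cos (s * u) * u) - - sin (s * u) * u) - 0) +
    ((u * sin (s * u) - cos (s * u)) * (oneDsqr u)^-1 - 1) * (expR (- s) * - 1) =
    expR (- s) * (1 + cos (s * u))).
  by rewrite /oneDsqr in o1 *; field.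
have F0 : F 0 = - (1 + (oneDsqr u)^-1).
  by rewrite /F oppr0 expR0 mul0r sin0 cos0; field.
have cvgd (f : R -> R) (s l : R) : is_derive s 1 f l -> f t @[t --> s] --> f s.
  move=> df; apply: differentiable_continuous; apply/derivable1_diffP.
  by case: df.
pose C := (`|u| + 1) / oneDsqr u + 1.
rewrite (@ge0_continuous_FTC2y _ _ F 0 0)//.
- by rewrite F0 sub0e -EFinN opprK.
- apply: continuous_subspaceT => s; apply: cvgM; first exact: cvgd (dexp s).
  by apply: cvgD; [exact: cvg_cst|exact: cvgd (dcos s)].
- have cC : (C * expR (- s)) @[s --> +oo] --> C * 0.
    by apply: cvgMl_tmp; exact: cvgr_expR.
  rewrite mulr0 in cC.
  have cNC : (- (C * expR (- s))) @[s --> +oo] --> (0 : R).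
    by rewrite -oppr0; exact: cvgN.
  apply: (squeeze_cvgr _ cNC cC); apply: nearW => s.
  rewrite -ler_norml /F normrM (ger0_norm (expR_ge0 _)) mulrC ler_pM2r ?expR_gt0//.
  apply: le_trans (ler_normB _ _) _; rewrite normr1 lerD2r normrM.
  rewrite (@ger0_norm _ (oneDsqr u)^-1) ?invr_ge0 ?(le_trans ler01) ?oneDsqr_ge1//.
  rewrite ler_wpM2r ?invr_ge0 ?(le_trans ler01) ?oneDsqr_ge1//.
  apply: le_trans (ler_normB _ _) _; rewrite normrM lerD//.
    by rewrite ler_piMr// ler_norml sin_geN1 sin_le1.
  by rewrite ler_norml cos_geN1 cos_le1.
- exact/cvg_at_right_filter/(cvgd _ _ _ (dF 0)).
- by move=> s _; rewrite derive1E; apply: derive_val.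
Qed.

Lemma integral_EFin_indicM d (T : measurableType d) (m : {measure set T -> \bar R})
    (D : set T) (f : T -> R) : measurable D ->
  (\int[m]_(x in D) (f x)%:E = \int[m]_x (\1_D x * f x)%:E)%E.
Proof.
move=> mD; rewrite integral_mkcond; apply: eq_integral => x _.
by rewrite patchE indicE; case: ifP => _; rewrite ?mul1r ?mul0r.
Qed.

(** The Cauchy kernel is the cosine transform of the exponential density; the
    integrand is kept nonnegative by adding 1 to the cosine. *)
Lemma integral_cauchy_kernel d (T : measurableType d) (P : probability T R)
    (U : T -> R) : measurable_fun setT U ->
  (forall s, 0 <= \int[P]_w cos (s * U w)) ->
  (\int[P]_w ((oneDsqr (U w))^-1)%:E =
   \int[mu]_s (\1_(`[0%R, +oo[%classic) s *
                (expR (- s) * \int[P]_w cos (s * U w)))%:E)%E.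
Proof.
move=> mU cos0.
pose D : set R := `[0, +oo[%classic.
have mD : measurable D by exact: measurable_itv.
have mP (p : T * R) : 0 <= \1_D p.2 * (expR (- p.2) * (1 + cos (p.2 * U p.1))).
  by rewrite !mulr_ge0 ?expR_ge0// addrC -lerBlDr sub0r cos_geN1.
have mexp : measurable_fun setT (fun s : R => expR (- s)).
  by apply: measurableT_comp => //; exact: measurable_expR.
have mf : measurable_fun setT (fun p : T * measurableTypeR R =>
    (\1_D p.2 * (expR (- p.2) * (1 + cos (p.2 * U p.1))))%:E).
  apply/measurable_EFinP; apply: measurable_funM.
    apply: (measurableT_comp _ measurable_snd); exact: measurable_indic.
  apply: measurable_funM; first exact: (measurableT_comp mexp measurable_snd).
  apply: measurable_funD => //.
  suff [] : bounded_mfun (fun p : T * measurableTypeR R => cos (p.2 * U p.1)) by [].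
  apply: bounded_mfun_cos; apply: measurable_funM; first exact: measurable_snd.
  exact: (measurableT_comp mU measurable_fst).
have bcos s : bounded_mfun (fun w => cos (s * U w)).
  by apply: bounded_mfun_cos; exact: measurable_funM.
have one : (\int[P]_w (1 : R)%:E = 1)%E.
  by rewrite integral_cst// mul1e; exact: (@probability_setT _ _ _ P).
have cos1 s : (\int[P]_w (1 + cos (s * U w))%:E = (1 + \int[P]_w cos (s * U w))%:E)%E.
  under eq_integral do rewrite EFinD.
  rewrite integralD_EFin//; last 2 first.
  - by apply: bounded_mfun_integrable; split => [|w]; [exact: measurable_cst|rewrite normr1].
  - exact: bounded_mfun_integrable (bcos s).
  by rewrite one (EFin_Rintegral _ (bcos s)).
have cosU : measurable_fun setT (fun p : T * measurableTypeR R => 1 + cos (p.2 * U p.1)).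
  apply: measurable_funD => //.
  suff [] : bounded_mfun (fun p : T * measurableTypeR R => cos (p.2 * U p.1)) by [].
  apply: bounded_mfun_cos; apply: measurable_funM; first exact: measurable_snd.
  exact: (measurableT_comp mU measurable_fst).
have mcos : measurable_fun setT (fun s : measurableTypeR R => \int[P]_w cos (s * U w)).
  have : measurable_fun setT (fun s : measurableTypeR R => (1 + \int[P]_w cos (s * U w))%:E).
    under eq_fun do rewrite -cos1.
    apply: (@measurable_fun_fubini_tonelli_G _ _ _ _ _ P
      (fun p : T * measurableTypeR R => (1 + cos (p.2 * U p.1))%:E)) => [|p].
      exact/measurable_EFinP.
    by rewrite lee_fin addrC -lerBlDr sub0r cos_geN1.
  move=> /measurable_EFinP mc1.
  rewrite (_ : (fun s => _) = (fun s : measurableTypeR R => (1 + \int[P]_w cos (s * U w)) - 1)).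
    exact: measurable_funB.
  by apply/funext => s; rewrite addrC addKr.
have int_exp : (\int[mu]_s (\1_D s * expR (- s))%:E = 1)%E.
  have h2 : (2%:E * \int[mu]_s (\1_D s * expR (- s))%:E = 2%:E)%E.
    rewrite -ge0_integralZl//; last first.
      by apply/measurable_EFinP; apply: measurable_funM => //; exact: measurable_indic.
    have := integral_expR_cos 0; rewrite integral_EFin_indicM//.
    rewrite (_ : 1 + (oneDsqr 0)^-1 = 2 :> R); last first.
      by rewrite /oneDsqr expr0n addr0 invr1.
    move=> e2; rewrite -[RHS]e2; apply: eq_integral => s _.
    rewrite -EFinM mulr0 trigo.cos0.
    by congr EFin; ring.
  by rewrite -[LHS]mul1e -(@mulVf _ 2)// EFinM -muleA h2 -EFinM mulVf.
have := @fubini_tonelli _ _ _ _ _ P mu _ mf (fun p => mP p).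
rewrite /fubini_F /fubini_G/=.
have -> : (\int[P]_w \int[mu]_s (\1_D s * (expR (- s) * (1 + cos (s * U w))))%:E =
    1 + \int[P]_w ((oneDsqr (U w))^-1)%:E)%E.
  under eq_integral do rewrite -integral_EFin_indicM// integral_expR_cos EFinD.
  rewrite ge0_integralD//; last first.
    apply/measurable_EFinP.
    have mo : measurable_fun setT (fun x : R => (oneDsqr x)^-1).
      by apply: continuous_measurable_fun; exact: continuous_oneDsqrV.
    exact: (measurableT_comp mo mU).
  by rewrite one.
have -> : (\int[mu]_s \int[P]_w (\1_D s * (expR (- s) * (1 + cos (s * U w))))%:E =
    1 + \int[mu]_s (\1_D s * (expR (- s) * \int[P]_w cos (s * U w)))%:E)%E.
  rewrite -int_exp -ge0_integralD//; last 3 first.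
  - by apply/measurable_EFinP; apply: measurable_funM => //; exact: measurable_indic.
  - by move=> s _; rewrite lee_fin !mulr_ge0 ?expR_ge0.
  - apply/measurable_EFinP; apply: measurable_funM; first exact: measurable_indic.
    exact: measurable_funM.
  apply: eq_integral => s _; under eq_integral do rewrite mulrA EFinM.
  rewrite ge0_integralZl//; last first.
    by apply/measurable_EFinP; apply: measurable_funD => //; exact: (bcos s).1.
  by rewrite cos1 -EFinM -EFinD; congr EFin; ring.
move=> hh; apply/eqP; rewrite eq_le.
by rewrite -(@leeD2lE _ 1%E)// hh lexx -(@leeD2lE _ 1%E)// hh lexx.
Qed.

End exp_cos.

(** * Geometric means of integrals *)

Section hoelder_log_convexity.
Context d (T : measurableType d) (R : realType) (mu : {measure set T -> \bar R}).

(** Hoelder's inequality for the exponents [1 / l] and [1 / (1 - l)]. *)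
Lemma integral_geometric_mean (f g h : T -> R) (l : R) : 0 < l < 1 ->
  measurable_fun setT f -> measurable_fun setT g -> measurable_fun setT h ->
  (forall x, 0 <= f x) -> (forall x, 0 <= g x) -> (forall x, 0 <= h x) ->
  (forall x, h x <= f x `^ l * g x `^ (1 - l)) ->
  (\int[mu]_x (h x)%:E <=
   (\int[mu]_x (f x)%:E) `^ l * (\int[mu]_x (g x)%:E) `^ (1 - l)%R)%E.
Proof.
move=> /andP[l0 l1] mf mg mh f0 g0 h0 hfg.
have l1' : 0 < 1 - l by rewrite subr_gt0.
have mfl : measurable_fun setT (fun x => f x `^ l).
  exact: (measurableT_comp (measurable_powR l) mf).
have mgl : measurable_fun setT (fun x => g x `^ (1 - l)).
  exact: (measurableT_comp (measurable_powR (1 - l)) mg).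
have normE (k : T -> R) (p : R) : 0 < p -> (forall x, 0 <= k x) ->
    Lnorm mu (p^-1)%:E (EFin \o (fun x => k x `^ p)) = ((\int[mu]_x (k x)%:E) `^ p)%E.
  move=> p0 k0; rewrite unlock invrK; congr (_ `^ _)%E; apply: eq_integral => x _.
  rewrite /= ger0_norm ?powR_ge0// -powRrM mulfV ?gt_eqF// powRr1//.
have := @hoelder _ _ _ mu _ _ _ _ mfl mgl.
move=> /(_ l^-1 (1 - l)^-1); rewrite !invrK !invr_gt0 => /(_ l0 l1').
rewrite addrC subrK => /(_ erefl).
rewrite (normE f l l0 f0) (normE g (1 - l) l1' g0) Lnorm1.
apply: le_trans; apply: ge0_le_integral => //.
- by move=> x _; rewrite lee_fin.
- exact/measurable_EFinP.
- by apply/measurable_EFinP; apply: measurableT_comp => //; exact: measurable_funM.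
- by move=> x _ /=; rewrite lee_fin ger0_norm ?mulr_ge0 ?powR_ge0.
Qed.

End hoelder_log_convexity.

Section limits.
Context {R : realType}.

Lemma limn_einf_le_cvg (u v : (\bar R)^nat) (l : \bar R) :
  (forall n, (u n <= v n)%E) -> v @ \oo --> l -> (limn_einf u <= l)%E.
Proof.
move=> uv vl; rewrite limn_einf_lim -(cvg_lim _ vl)//.
apply: lee_lim; [exact: is_cvg_einfs|by apply/cvg_ex; exists l|].
apply: nearW => n; apply: le_trans (uv n); apply: ereal_inf_lbound.
by exists n => //=.
Qed.

Lemma cvg_powR (u : R^nat) (a l : R) : 0 < a -> u @ \oo --> a ->
  (u n `^ l) @[n --> \oo] --> a `^ l.
Proof.
move=> a0 ua.
have -> : a `^ l = expR (l * ln a) by rewrite /powR gt_eqF.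
have : (expR (l * ln (u n))) @[n --> \oo] --> expR (l * ln a).
  apply: continuous_cvg; first exact: continuous_expR.
  by apply: cvgMl_tmp; apply: continuous_cvg => //; exact: continuous_ln.
apply: cvg_trans; apply: near_eq_cvg; near=> n.
rewrite /powR gt_eqF//; near: n.
exact: (cvgr_gt _ ua).
Unshelve. all: by end_near. Qed.

End limits.

(** * Log-convexity of the expected Cauchy averages *)

Section fourier_side.
Context (R : realType) (m n : nat) (disp : measure_display)
  (Omega : measurableType disp) (P : probability Omega R).
(* [psi] stands for the real part of the common Fourier transform. *)
Variables (X : 'I_n -> Omega -> 'rV[R]_m.+1) (psi : 'rV[R]_m.+1 -> R).
Variable L : set 'rV[R]_m.+1.
Hypothesis mX : forall i, measurable_fun setT (X i).
Hypothesis indX : mutually_independent P X.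
Hypothesis cosX : forall i t, \int[P]_w cos (2 * pi * dotp t (X i w)) = psi t.
Hypothesis sinX : forall i t, \int[P]_w sin (2 * pi * dotp t (X i w)) = 0.
Hypothesis psi0 : forall t, 0 <= psi t.
Hypothesis mpsi : measurable_fun setT psi.
Hypothesis lcpsi : forall t (x y l : R), 0 <= x -> 0 <= y -> 0 < l < 1 ->
  psi (Num.sqrt (l * x + (1 - l) * y) *: t) <=
  psi (Num.sqrt x *: t) `^ l * psi (Num.sqrt y *: t) `^ (1 - l).
Hypothesis mL : measurable L.
Local Notation mu := (@lebesgue_measure R).

(** The sum whose norm the theorem averages. *)
Definition weighted_sum (a : 'rV[R]_n) (w : Omega) : 'rV[R]_m.+1 :=
  \sum_(i < n) Num.sqrt (a ord0 i) *: X i w.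

Lemma measurable_weighted_sum a : measurable_fun setT (weighted_sum a).
Proof.
apply: measurable_rV_sum => i; apply: measurable_rVZ => //.
Qed.

(** The value at [t] of the characteristic function of [weighted_sum a]. *)
Definition fourier_prod (a : 'rV[R]_n) (t : 'rV[R]_m.+1) : R :=
  \prod_(i < n) psi (Num.sqrt (a ord0 i) *: t).

Let fourier_prod_ge0 a t : 0 <= fourier_prod a t.
Proof. exact: prodr_ge0. Qed.

Lemma Rintegral_cos_weighted_sum a (t : 'rV[R]_m.+1) :
  \int[P]_w cos (2 * pi * dotp t (weighted_sum a w)) = fourier_prod a t.
Proof.
pose u i (x : 'rV[R]_m.+1) := 2 * pi * dotp (Num.sqrt (a ord0 i) *: t) x.
have mu_ i : measurable_fun setT (u i).
  apply: measurable_funM => //; apply: measurable_dotp => //.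
rewrite /fourier_prod -(Rintegral_cos_independent_sum mX indX mu_).
- apply: eq_Rintegral => w _; congr cos.
  rewrite /u -mulr_sumr; congr (_ * _); rewrite dotpE /weighted_sum linear_sum/= mulmx_sumr summxE.
  apply: eq_bigr => i _; rewrite linearZ/= -scalemxAr dotpE -scalemxAl.
  by rewrite !mxE.
- by move=> i; exact: cosX.
- by move=> i; exact: sinX.
Qed.

(** The positive weight and the frequency in the representation of
    [cauchy_average] by cosines. The points of integration are the pairs [(y, s)]
    of a point of [L] and of the variable of the exponential; [2 * pi] comes from
    the normalization of the Fourier transform. *)
Definition weight (N : R) (p : 'rV[R]_m.+1 * measurableTypeR R) : R :=
  \1_L p.1 * N * (\1_(`[0%R, +oo[%classic : set R) p.2 * expR (- p.2)).

Definition freq (N : R) (p : 'rV[R]_m.+1 * measurableTypeR R) : 'rV[R]_m.+1 :=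
  (p.2 * N / (2 * pi)) *: p.1.

Let weight_ge0 N p : 0 <= N -> 0 <= weight N p.
Proof. by move=> N0; rewrite !mulr_ge0 ?expR_ge0. Qed.

Let measurable_weight N : measurable_fun setT (weight N).
Proof.
apply: measurable_funM.
  apply: measurable_funM => //; apply: (measurableT_comp _ measurable_fst).
  exact: measurable_indic.
apply: measurable_funM.
  apply: (measurableT_comp (f := \1_(`[0%R, +oo[%classic : set R) : R -> R) _ measurable_snd).
  by apply: measurable_indic; exact: measurable_itv.
have mexp : measurable_fun setT (fun s : R => expR (- s)).
  by apply: measurableT_comp => //; exact: measurable_expR.
exact: (measurableT_comp mexp measurable_snd).
Qed.

Let measurable_fourier_prod N a :
  measurable_fun setT (fun p => fourier_prod a (freq N p)).
Proof.
apply: (@measurable_prod _ _ _ _ _ (index_enum 'I_n)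
  (fun i p => psi (Num.sqrt (a ord0 i) *: freq N p))) => i _.
apply: (measurableT_comp mpsi); apply: measurable_rVZ => //.
apply: measurable_rVZ; last exact: measurable_fst.
by apply: measurable_funM => //; apply: measurable_funM.
Qed.

Lemma expectation_cauchy_average (N : R) (a : 'rV[R]_n) : 0 < N ->
  (\int[P]_w cauchy_average L N (weighted_sum a w) =
   \int[(@lebesgue_rV R m.+1 \x @lebesgue_measure R)%E]_p (weight N p * fourier_prod a (freq N p))%:E)%E.
Proof.
move=> N0; have N0' := ltW N0.
pose m2 : {sigma_finite_measure set 'rV[R]_m.+1 -> \bar R} := @lebesgue_rV R m.+1.
have mS := measurable_weighted_sum a.
rewrite fubini_tonelli1; last 2 first.
- by apply/measurable_EFinP; apply: measurable_funM.
- by move=> p; rewrite lee_fin mulr_ge0// weight_ge0.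
rewrite /fubini_F.
transitivity (\int[m2]_y \int[P]_w
    (\1_L y * (N * (oneDsqr (N * dotp (weighted_sum a w) y))^-1))%:E)%E.
  apply: (@fubini_tonelli _ _ _ _ _ P m2 (fun p : Omega * 'rV[R]_m.+1 =>
    (\1_L p.2 * (N * (oneDsqr (N * dotp (weighted_sum a p.1) p.2))^-1))%:E)) => [|p].
    apply/measurable_EFinP; apply: measurable_funM.
      by apply: (measurableT_comp _ measurable_snd); exact: measurable_indic.
    apply: measurable_cauchy_kernel; apply: measurable_dotp.
      exact: (measurableT_comp mS measurable_fst).
    exact: measurable_snd.
  by rewrite lee_fin !mulr_ge0// invr_ge0 (le_trans ler01) ?oneDsqr_ge1.
apply: eq_integral => y _ /=.
have mU : measurable_fun setT (fun w => N * dotp (weighted_sum a w) y).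
  apply: measurable_funM => //; apply: measurable_dotp => //.
under eq_integral do rewrite mulrA EFinM.
rewrite ge0_integralZl//; last 2 first.
- apply/measurable_EFinP.
  have mo : measurable_fun setT (fun x : R => (oneDsqr x)^-1).
    by apply: continuous_measurable_fun; exact: continuous_oneDsqrV.
  exact: (measurableT_comp mo mU).
- by rewrite lee_fin mulr_ge0.
have cosE s : \int[P]_w cos (s * (N * dotp (weighted_sum a w) y)) =
    fourier_prod a (freq N (y, s)).
  rewrite -Rintegral_cos_weighted_sum; apply: eq_Rintegral => w _; congr cos.
  rewrite dotpC /freq/= [in RHS]dotpE -scalemxAl mxE -dotpE.
  have pi2 : 2 * pi != 0 :> R by rewrite gt_eqF// mulr_gt0// pi_gt0.
  by rewrite mulrA [RHS]mulrA [2 * pi * _]mulrC divfK.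
rewrite (integral_cauchy_kernel mU); last by move=> s; rewrite cosE.
under eq_integral do rewrite cosE.
rewrite -ge0_integralZl//; last 3 first.
- apply/measurable_EFinP; apply: measurable_funM.
    by apply: measurable_indic; exact: measurable_itv.
  apply: measurable_funM.
    by apply: measurableT_comp => //; exact: measurable_expR.
  exact: (measurableT_comp (measurable_fourier_prod N a) (@pair1_measurable _ _ _ _ y)).
- by move=> s _; rewrite lee_fin !mulr_ge0 ?expR_ge0.
- by rewrite lee_fin mulr_ge0.
by apply: eq_integral => s _; rewrite -EFinM /weight/=; congr EFin; ring.
Qed.

Lemma fourier_prod_log_convex (a b : 'rV[R]_n) (l : R) t : 0 < l < 1 ->
  (forall i, 0 <= a ord0 i) -> (forall i, 0 <= b ord0 i) ->
  fourier_prod (l *: a + (1 - l) *: b) t <=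
  fourier_prod a t `^ l * fourier_prod b t `^ (1 - l).
Proof.
move=> l01 a0 b0.
pose K (z x y : R) := [/\ 0 <= z, 0 <= x, 0 <= y & z <= x `^ l * y `^ (1 - l)].
suff [] : K (fourier_prod (l *: a + (1 - l) *: b) t) (fourier_prod a t) (fourier_prod b t) by [].
rewrite /fourier_prod; apply: (big_ind3 K).
- by split => //; rewrite !powR1 mulr1.
- move=> z x y z' x' y' [z0 x0 y0 zxy] [z0' x0' y0' zxy']; split; rewrite ?mulr_ge0//.
  by rewrite !powRM// mulrACA ler_pM.
by move=> i _; split => //; rewrite !mxE; exact: lcpsi.
Qed.

Lemma expectation_cauchy_average_log_convex (N : R) (a b : 'rV[R]_n) (l : R) :
  0 < N -> 0 < l < 1 ->
  (forall i, 0 <= a ord0 i) -> (forall i, 0 <= b ord0 i) ->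
  (\int[P]_w cauchy_average L N (weighted_sum (l *: a + (1 - l) *: b) w) <=
   (\int[P]_w cauchy_average L N (weighted_sum a w)) `^ l *
   (\int[P]_w cauchy_average L N (weighted_sum b w)) `^ (1 - l)%R)%E.
Proof.
move=> N0 l01 a0 b0.
have subst_le (x y z x' y' z' : \bar R) : x = x' -> y = y' -> z = z' ->
    (x' <= y' `^ l * z' `^ (1 - l)%R -> x <= y `^ l * z `^ (1 - l)%R)%E.
  by move=> -> -> ->.
apply: (subst_le _ _ _ _ _ _ (expectation_cauchy_average _ N0)
  (expectation_cauchy_average a N0) (expectation_cauchy_average b N0)).
have W0 p := weight_ge0 p (ltW N0).
apply: integral_geometric_mean => //.
- exact: measurable_funM.
- exact: measurable_funM.
- exact: measurable_funM.
- by move=> p; rewrite mulr_ge0.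
- by move=> p; rewrite mulr_ge0.
- by move=> p; rewrite mulr_ge0.
move=> p; rewrite (powRM _ (W0 p) (fourier_prod_ge0 a _)).
rewrite (powRM _ (W0 p) (fourier_prod_ge0 b _)) mulrACA.
have -> : weight N p `^ l * weight N p `^ (1 - l) = weight N p.
  have l1 : l + (1 - l) = 1 by rewrite addrC subrK.
  by rewrite -powRD l1 ?powRr1// oner_eq0.
by rewrite ler_wpM2l// fourier_prod_log_convex.
Qed.

End fourier_side.

(** * Passage to the limit *)

Section passage_to_the_limit.
Context d (T : measurableType d) (R : realType) (P : probability T R).
Variables (k C : R).
Hypotheses (k0 : 0 < k) (C0 : 0 < C).

Let measurable_limit (f : T -> \bar R) (g : nat -> T -> \bar R) :
  (forall n, measurable_fun setT (g n)) ->
  (forall w, g n w @[n --> \oo] --> (k%:E * f w)%E) ->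
  measurable_fun setT f.
Proof.
move=> mg gf.
rewrite (_ : f = fun w => ((k^-1)%:E * (k%:E * f w))%E); last first.
  by apply/funext => w; rewrite muleA -EFinM mulVf ?gt_eqF// mul1e.
apply: emeasurable_funM; first exact: measurable_cst.
by apply: (emeasurable_fun_cvg g) => // w _; exact: gf.
Qed.

Let integral_gt0 (f : T -> \bar R) : measurable_fun setT f ->
  (forall w, 0 < f w)%E -> (0 < \int[P]_w f w)%E.
Proof.
move=> mf f0; rewrite lt0e integral_ge0 ?andbT; last by move=> w _; exact: ltW.
apply/negP => /eqP If0.
have : ae_eq P setT f (cst 0%E).
  apply/ae_eq_integral_abs => //.
  by under eq_integral do rewrite gee0_abs ?(ltW (f0 _))//.
move=> [A [mA A0 sA]].
have AT : A = setT.
  by apply/seteqP; split => // w _; apply: sA => /= /(_ I) fw; have := f0 w; rewrite fw ltxx.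
move: A0; rewrite AT => P0; have := @probability_setT _ _ _ P.
by rewrite P0 => /eqP; rewrite eq_sym onee_eq0.
Qed.

Let integral_cvg (f : T -> \bar R) (g : nat -> T -> \bar R) :
  (forall w, 0 <= f w)%E ->
  (forall n, measurable_fun setT (g n)) -> (forall n w, 0 <= g n w)%E ->
  (forall w, g n w @[n --> \oo] --> (k%:E * f w)%E) ->
  (forall n w, (g n w <= C%:E * f w)%E) ->
  (\int[P]_w f w < +oo)%E ->
  (\int[P]_w g n w)%E @[n --> \oo] --> (k%:E * \int[P]_w f w)%E.
Proof.
move=> f0 mg g0 gf gC If; have mf := measurable_limit mg gf.
have iC : P.-integrable setT (fun w => C%:E * f w)%E.
  apply: integrableZl => //; apply/integrableP; split => //.
  by under eq_integral do rewrite gee0_abs//.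
have ae1 : {ae P, forall w, setT w -> g ^~ w @ \oo --> (k%:E * f w)%E}.
  by apply: aeW => w _; exact: gf.
have ae2 : {ae P, forall w n, setT w -> (`|g n w| <= C%:E * f w)%E}.
  by apply: aeW => w n _; rewrite gee0_abs.
have mkf : measurable_fun setT (fun w => k%:E * f w)%E.
  by apply: emeasurable_funM => //; exact: measurable_cst.
have [_ _] := dominated_convergence measurableT mg mkf ae1 iC ae2.
by rewrite ge0_integralZl// lee_fin ltW.
Qed.

(** Fatou's lemma bounds [fc] from above, dominated convergence identifies the
    limits for [fa] and [fb]. If [fa] or [fb] has an infinite integral, then so is
    the right-hand side, the other integral being positive. *)
Lemma geometric_mean_limit (l : R) (fa fb fc : T -> \bar R)
    (ga gb gc : nat -> T -> \bar R) : 0 < l < 1 ->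
  (forall w, 0 < fa w)%E -> (forall w, 0 < fb w)%E -> (forall w, 0 <= fc w)%E ->
  (forall n, measurable_fun setT (ga n)) ->
  (forall n, measurable_fun setT (gb n)) ->
  (forall n, measurable_fun setT (gc n)) ->
  (forall n w, 0 <= ga n w)%E -> (forall n w, 0 <= gb n w)%E ->
  (forall n w, 0 <= gc n w)%E ->
  (forall w, ga n w @[n --> \oo] --> (k%:E * fa w)%E) ->
  (forall w, gb n w @[n --> \oo] --> (k%:E * fb w)%E) ->
  (forall w, gc n w @[n --> \oo] --> (k%:E * fc w)%E) ->
  (forall n w, (ga n w <= C%:E * fa w)%E) ->
  (forall n w, (gb n w <= C%:E * fb w)%E) ->
  (forall n, (\int[P]_w gc n w <=
    (\int[P]_w ga n w) `^ l * (\int[P]_w gb n w) `^ (1 - l)%R)%E) ->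
  (\int[P]_w fc w <= (\int[P]_w fa w) `^ l * (\int[P]_w fb w) `^ (1 - l)%R)%E.
Proof.
move=> /andP[l0 l1] fa0 fb0 fc0 mga mgb mgc ga0 gb0 gc0 cva cvb cvc gaC gbC gabc.
have l1' : 0 < 1 - l by rewrite subr_gt0.
have Ia0 := integral_gt0 (measurable_limit mga cva) fa0.
have Ib0 := integral_gt0 (measurable_limit mgb cvb) fb0.
have [Ia|Ia] := eqVneq (\int[P]_w fa w)%E +oo%E.
  by rewrite Ia poweRyr ?gt_eqF// gt0_mulye ?leey// poweR_gt0.
have [Ib|Ib] := eqVneq (\int[P]_w fb w)%E +oo%E.
  by rewrite Ib poweRyr ?gt_eqF// gt0_muley ?leey// poweR_gt0.
have {}Ia : (\int[P]_w fa w < +oo)%E by rewrite ltey.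
have {}Ib : (\int[P]_w fb w < +oo)%E by rewrite ltey.
have cIa := integral_cvg (fun w => ltW (fa0 w)) mga ga0 cva gaC Ia.
have cIb := integral_cvg (fun w => ltW (fb0 w)) mgb gb0 cvb gbC Ib.
have mfc := measurable_limit mgc cvc.
have fatou_c : (k%:E * \int[P]_w fc w <= limn_einf (fun n => \int[P]_w gc n w))%E.
  rewrite -ge0_integralZl// ?lee_fin ?(ltW k0)//.
  apply: le_trans (fatou P measurableT mgc (fun n w _ => gc0 n w)).
  rewrite le_eqVlt; apply/orP; left; apply/eqP/eq_integral => w _.
  by rewrite (cvg_limn_einf_sup (cvc w)).1.
have fin (f : T -> \bar R) : (0 < \int[P]_w f w)%E -> (\int[P]_w f w < +oo)%E ->
    (\int[P]_w f w)%E \is a fin_num.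
  by move=> f0 foo; rewrite ge0_fin_numE ?ltW.
pose A := fine (\int[P]_w fa w)%E; pose B := fine (\int[P]_w fb w)%E.
have AE : (\int[P]_w fa w)%E = A%:E by rewrite fineK ?fin.
have BE : (\int[P]_w fb w)%E = B%:E by rewrite fineK ?fin.
have A0 : 0 < A by rewrite -lte_fin -AE.
have B0 : 0 < B by rewrite -lte_fin -BE.
have cvAB : ((\int[P]_w ga n w) `^ l * (\int[P]_w gb n w) `^ (1 - l)%R)%E @[n --> \oo] -->
    (k%:E * ((\int[P]_w fa w) `^ l * (\int[P]_w fb w) `^ (1 - l)%R))%E.
  rewrite AE BE !poweR_EFin -!EFinM.
  have -> : k * (A `^ l * B `^ (1 - l)) = (k * A) `^ l * (k * B) `^ (1 - l).
    rewrite !powRM ?(ltW A0) ?(ltW B0) ?(ltW k0)// mulrACA -powRD.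
      by rewrite (_ : l + (1 - l) = 1) ?powRr1 ?(ltW k0)//; ring.
    by rewrite (gt_eqF k0) implybT.
  have fin_g (f : T -> \bar R) (g : nat -> T -> \bar R) n :
      measurable_fun setT f -> (forall w, 0 <= f w)%E ->
      (forall n, measurable_fun setT (g n)) -> (forall n w, 0 <= g n w)%E ->
      (forall n w, (g n w <= C%:E * f w)%E) -> (\int[P]_w f w < +oo)%E ->
      (\int[P]_w g n w)%E = (fine (\int[P]_w g n w))%:E.
    move=> mf f0 mg g0 gC If; rewrite fineK// ge0_fin_numE ?integral_ge0//.
    apply: (@le_lt_trans _ _ (C%:E * \int[P]_w f w)%E); last first.
      by rewrite lte_mul_pinfty// lee_fin ltW.
    rewrite -ge0_integralZl// ?lee_fin ?(ltW C0)//.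
    by apply: ge0_le_integral => //; apply: emeasurable_funM => //; exact: measurable_cst.
  have fin_ga n := fin_g _ _ n (measurable_limit mga cva) (fun w => ltW (fa0 w)) mga ga0 gaC Ia.
  have fin_gb n := fin_g _ _ n (measurable_limit mgb cvb) (fun w => ltW (fb0 w)) mgb gb0 gbC Ib.
  under eq_fun do rewrite fin_ga fin_gb !poweR_EFin -EFinM.
  apply: cvg_EFin; first exact: nearW.
  rewrite AE -EFinM in cIa; rewrite BE -EFinM in cIb.
  by apply: cvgM; apply: cvg_powR; rewrite ?mulr_gt0//; exact: fine_cvg.
by have := le_trans fatou_c (limn_einf_le_cvg gabc cvAB); rewrite lee_pmul2l.
Qed.

End passage_to_the_limit.

(** * Conclusion *)

Theorem theorem1p3 (R : realType) (d n : nat) (d_ge2 : (2 <= d)%N)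
    (disp : measure_display) (Omega : measurableType disp)
    (P : probability Omega R)
    (X : 'I_n.+1 -> {RV P >-> 'rV[R]_d})
    (phi : 'rV[R]_d -> R) (K L : set 'rV[R]_d)
    (phihat := fourier (fun y => (phi y)%:C%C)) :
  mutually_independent P (fun i => X i : Omega -> 'rV[R]_d) ->
  measurable_fun setT phi ->
  (forall x, 0 <= phi x) ->
  (forall i (A : set 'rV[R]_d), measurable A ->
    distribution P (X i) A = (\int[@lebesgue_rV R d]_(x in A) (phi x)%:E)%E) ->
  (forall x, phi (- x) = phi x) ->
  (forall x, 0 <= phihat x) ->
  Cintegrable (@lebesgue_rV R d) setT phihat ->
  (forall t : 'rV[R]_d,
    log_convex_on (V := R^o) [set r : R | 0 <= r]
      (fun r : R => (complex.Re (phihat (Num.sqrt r *: t)))%:E)) ->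
  (forall N : R, 0 < N ->
    ('E_P[fun w => (enorm (X ord0 w) `^ N)%R] < +oo)%E) ->
  star_body K -> symmetric_set K ->
  star_body L -> symmetric_set L ->
  is_intersection_body K L ->
  (\int[P]_w (minkowski_functional K (X ord0 w))^-1 < +oo)%E ->
  log_convex_on [set a : 'rV[R]_n.+1 | forall i, 0 <= a ord0 i]
    (fun a => \int[P]_w
      (minkowski_functional K (\sum_(i < n.+1) Num.sqrt (a ord0 i) *: X i w)%R)^-1)%E.
Proof.
move=> indX mphi phi0 lawX _ phihat0 [iRe _] lcphi _ sK _ sL _ KL _.
case: d d_ge2 X phi K L @phihat indX mphi phi0 lawX phihat0 iRe lcphi sK sL KL => [//|m] _.
move=> X phi K L phihat indX mphi phi0 lawX phihat0 iRe lcphi sK sL KL.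
pose psi t := complex.Re (phihat t).
have psi0 t : 0 <= psi t by have := phihat0 t; rewrite lecE => /andP[].
have mpsi : measurable_fun setT psi.
  by apply/measurable_EFinP; exact: measurable_int iRe.
have mX i : measurable_fun setT (X i) by exact: measurable_funPT.
have cosX i t : \int[P]_w cos (2 * pi * dotp t (X i w)) = psi t.
  by rewrite -(Re_fourier_law (mX i) mphi phi0 (lawX i)).
have sinX i t : \int[P]_w sin (2 * pi * dotp t (X i w)) = 0.
  have := Im_fourier_law (mX i) mphi phi0 (lawX i) t.
  have := phihat0 t; rewrite lecE => /andP[/eqP -> _].
  by move=> /eqP; rewrite eq_sym oppr_eq0 => /eqP.
have {lcphi} lcpsi0 : forall t, log_convex_on (V := R^o) [set r : R | 0 <= r]
    (fun r : R => (psi (Num.sqrt r *: t))%:E) := lcphi.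
clearbody psi; clear phihat phihat0 iRe.
have lcpsi t (x y l : R) : 0 <= x -> 0 <= y -> 0 < l < 1 ->
    psi (Num.sqrt (l * x + (1 - l) * y) *: t) <=
    psi (Num.sqrt x *: t) `^ l * psi (Num.sqrt y *: t) `^ (1 - l).
  by move=> x0 y0 l01; have := lcpsi0 t x y l x0 y0 l01; rewrite !poweR_EFin -EFinM lee_fin.
have mL := star_body_measurable sL.
have [C C0 HC] := cauchy_average_intersection_body sK sL KL.
have mS a : measurable_fun setT (weighted_sum X a) by exact: measurable_weighted_sum.
pose G N (x : 'rV[R]_m.+1) := cauchy_average L N.+1%:R x.
have G0 N x : (0 <= G N x)%E by exact: cauchy_average_ge0.
have mG N : measurable_fun setT (G N) by exact: measurable_cauchy_average.
have I0 w : (0 <= (minkowski_functional K w)^-1)%E.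
  by rewrite inve_ge0 minkowski_functional_ge0.
have Ipos w : (0 < (minkowski_functional K w)^-1)%E.
  rewrite lt_neqAle I0 andbT eq_sym inve_eq0; apply/eqP => Kw.
  by case: sK => _ _ /(_ w); rewrite Kw.
move=> a b l a0 b0 l01.
pose c := l *: a + (1 - l) *: b.
have mGS N e : measurable_fun setT (fun w => G N (weighted_sum X e w)).
  exact: (measurableT_comp (mG N) (mS e)).
apply: (geometric_mean_limit (pi_gt0 R) C0 l01
  (fun w => Ipos (weighted_sum X a w)) (fun w => Ipos (weighted_sum X b w))
  (fun w => I0 (weighted_sum X c w))
  (fun N => mGS N a) (fun N => mGS N b) (fun N => mGS N c)
  (fun N w => G0 N _) (fun N w => G0 N _) (fun N w => G0 N _)
  (fun w => (HC _).1) (fun w => (HC _).1) (fun w => (HC _).1)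
  (fun N w => (HC _).2 N) (fun N w => (HC _).2 N)).
move=> N; exact: (expectation_cauchy_average_log_convex mX indX cosX sinX psi0 mpsi lcpsi mL).
Qed.
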